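(* Let $a,b\in L^\infty$ satisfy $a\neq 0$ a.e. on $\mathbb T$, $b\neq 0$ a.e. on $\mathbb T$, and either $a=b$ or $a-b\neq 0$ a.e. on $\mathbb T$. Let $\theta_1$ and $\theta_2$ be inner functions. Then $$\ker^+ S_{a\theta_1,\,b\overline{\theta_2}}\subseteq \ker^+ S_{a,b},$$ and, if $\ker^+ S_{a,b}\neq\{0\}$, the inclusion is proper if and only if $\theta_1\theta_2\notin\mathbb C$, that is, if and only if $\theta_1$ or $\theta_2$ is non-constant.
   Context: $\mathbb T$ is the unit circle, $\mathbb D$ the unit disc, $L^2=L^2(\mathbb T)$, $L^\infty=L^\infty(\mathbb T)$. $H^2_+=H^2(\mathbb D)$ is identified with a closed subspace of $L^2$ via boundary values, and $H^2_-=L^2\ominus H^2_+=\overline{H^2_0}$ (complex conjugates of functions in $H^2_+$ vanishing at $0$). $P^{\pm}$ are the orthogonal projections of $L^2$ onto $H^2_\pm$. For $a,b\in L^\infty$ the paired operator $S_{a,b}:L^2\to L^2$ is $S_{a,b}\phi=aP^+\phi+bP^-\phi$, and $\ker^{+}S_{a,b}:=P^{+}\ker S_{a,b}$. Thus $\phi_+\in\ker^+S_{a,b}$ iff $\phi_+\in H^2_+$ and there is $\phi_-\in H^2_-$ with $a\phi_++b\phi_-=0$. Inner functions are functions in $H^\infty(\mathbb D)$ that are unimodular a.e. on $\mathbb T$ (constants allowed). *)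

(* Defs.v *)
From HB Require Import structures.
From mathcomp Require Import all_boot all_order all_algebra.
From mathcomp Require Import complex.
From mathcomp Require Import all_classical all_reals all_analysis.
Set Implicit Arguments.
Unset Strict Implicit.
Unset Printing Implicit Defensive.
Import Order.TTheory GRing.Theory Num.Theory.
Import numFieldNormedType.Exports.
Import Normc.
Local Open Scope classical_set_scope.
Local Open Scope ring_scope.
Local Open Scope complex_scope.

(* A function on the unit circle is a function R -> R[i] of the angle t, of which
   only the values on [0, 2 pi] matter; it stands for e^{it} |-> f t.  Arc length
   is not normalized: the factor 1 / (2 pi) plays no role for membership in L^2,
   for orthogonality or for null sets.  Elements of L^2 and L^oo are handled as
   functions, equality being equality almost everywhere; all the subsets of L^2
   below are closed under it. *)
Section PairedOperators.
Variable R : realType.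
Implicit Types (f g h phi a b theta : R -> R[i]) (F : R[i] -> R[i]).

Definition angles : set R := `[0, 2 * pi]%classic.

Definition ae_circle (P : R -> Prop) : Prop :=
  {ae (@lebesgue_measure R), forall t, angles t -> P t}.

Definition eq_ae f g : Prop := ae_circle (fun t => f t = g t).

Definition measurable_circle f : Prop :=
  measurable_fun angles (fun t => complex.Re (f t)) /\
  measurable_fun angles (fun t => complex.Im (f t)).

Definition L2 : set (R -> R[i]) :=
  [set f | measurable_circle f /\
    (\int[@lebesgue_measure R]_(t in angles) ((normc (f t)) ^+ 2)%:E < +oo)%E].

Definition Linfty : set (R -> R[i]) :=
  [set f | measurable_circle f /\
    exists M : R, ae_circle (fun t => normc (f t) <= M)].

Definition integral_circle f : R[i] :=
  (\int[@lebesgue_measure R]_(t in angles) complex.Re (f t)) +i*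
  (\int[@lebesgue_measure R]_(t in angles) complex.Im (f t)).

Definition inner_product f g : R[i] := integral_circle (fun t => f t * conjc (g t)).

Definition disc : set R[i] := [set z | normc z < 1].

Definition polar (r t : R) : R[i] := (r * cos t) +i* (r * sin t).

(* R[i]^o is R[i] as a normed space over itself, so derivability is complex
   differentiability. *)
Definition holomorphic F : Prop :=
  forall z, disc z -> derivable (F : R[i]^o -> R[i]^o) z 1.

Definition H2_disc : set (R[i] -> R[i]) :=
  [set F | holomorphic F /\
    exists M : R, forall r : R, 0 <= r < 1 ->
      (\int[@lebesgue_measure R]_(t in angles)
         ((normc (F (polar r t))) ^+ 2)%:E <= M%:E)%E].

Definition Hinfty_disc : set (R[i] -> R[i]) :=
  [set F | holomorphic F /\ exists M : R, forall z, disc z -> normc (F z) <= M].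

(* radial limits almost everywhere *)
Definition boundary_value F f : Prop :=
  ae_circle (fun t => (F (polar r t) : R[i]^o) @[r --> (1 : R)^'-] --> (f t : R[i]^o)).

Definition H2p : set (R -> R[i]) :=
  [set f | L2 f /\ exists2 F, H2_disc F & boundary_value F f].

Definition H2m : set (R -> R[i]) :=
  [set f | L2 f /\ forall h, H2p h -> inner_product f h = 0].

(* The orthogonal projection of phi onto the subspace V of L^2.  It is determined
   up to equality almost everywhere, and exists for all phi in L^2 when V is
   closed, as H2p and H2m are; the default value 0 is then never used. *)
Definition orthogonal_projection (V : set (R -> R[i])) phi : R -> R[i] :=
  xget (fun=> 0)
    [set p | V p /\ forall h, V h -> inner_product (fun t => phi t - p t) h = 0].

Definition Pp : (R -> R[i]) -> R -> R[i] := orthogonal_projection H2p.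

Definition Pm : (R -> R[i]) -> R -> R[i] := orthogonal_projection H2m.

Definition paired_operator a b phi : R -> R[i] :=
  fun t => a t * Pp phi t + b t * Pm phi t.

Definition ker_paired a b : set (R -> R[i]) :=
  [set phi | L2 phi /\ eq_ae (paired_operator a b phi) (fun=> 0)].

Definition kerp_paired a b : set (R -> R[i]) :=
  [set g | L2 g /\ exists2 phi, ker_paired a b phi & eq_ae g (Pp phi)].

Definition zero_subspace : set (R -> R[i]) := [set f | L2 f /\ eq_ae f (fun=> 0)].

Definition inner_function theta : Prop :=
  [/\ measurable_circle theta,
      exists2 F, Hinfty_disc F & boundary_value F theta &
      ae_circle (fun t => normc (theta t) = 1)].

Definition constant_circle f : Prop := exists c : R[i], eq_ae f (fun=> c).

End PairedOperators.

(* Main.v *)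
Require Import Defs.
From mathcomp Require Import all_boot all_order all_algebra.
From mathcomp Require Import complex ring lra zify.
From mathcomp Require Import all_classical all_reals all_analysis measurable_realfun.
Set Implicit Arguments.
Unset Strict Implicit.
Unset Printing Implicit Defensive.
Import Order.TTheory GRing.Theory Num.Theory.
Import numFieldNormedType.Exports.
Import Normc.
Local Open Scope classical_set_scope.
Local Open Scope ring_scope.
Local Open Scope complex_scope.

(** Elements of the kernel of a paired operator are pairs [p + m], with [p] in the Hardy
    space [H2p] and [m] in its orthogonal complement [H2m], such that [a p + b m = 0]
    ([kerp_pairedP]); the projections of [p + m] are [p] and [m].  Write [theta] for
    [theta1 theta2].

    Inclusion.  From [a theta1 p + b (conj theta2) m = 0] and [|theta1| = 1] one gets
    [a p + b (conj theta) m = 0], and [conj theta] preserves [H2m] because [theta]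
    preserves [H2p] ([twisted_kerp_sub]).  If [theta] is a constant, the argument can
    be reversed ([constant_twisted_kerp]).

    Properness.  If the kernels coincide, comparing the two equations for the same [p] gives
    [theta m] in [H2m], and [(theta p, theta m)] is again a pair for [a] and [b].
    Iterating, [theta ^ N m] lies in [H2m] for all [N]; a nonconstant inner function does
    not allow this unless [m = 0] ([inner_rigidity]), and then [p = 0] as [a] does not
    vanish.

    Rigidity.  Let [F] be the holomorphic function with boundary values [theta] and
    [c = F 0], the mean of [theta].  The variance of [theta] is [1 - |c| ^ 2], so that
    [|c| < 1] unless [theta] is constant ([inner_variance]).  The function
    [((F - c) / z) ^ n z ^ k] has nonnegative frequencies on every circle, hence so has
    its limit on the unit circle, and [theta ^ (n + i) m] is orthogonal to it.  Since
    [theta (conj (theta - c)) = 1 - (conj c) theta] on the circle, this reads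
    [int m theta ^ i (1 - (conj c) theta) ^ n z ^ (n - k) = 0] for all [n, i, k].  The
    factor [1 - (conj c) theta] can be divided out, because [|c| < 1] makes its inverse
    a uniformly convergent series in [theta] ([twist_down]); so all the Fourier
    coefficients of [m] vanish, and [m = 0] ([character_complete]).

    Two pieces of analysis carry this.  The vanishing of the negative moments of a
    holomorphic function ([vanishing_moments]) comes from Goursat's theorem on
    rectangles ([circulation_eq0]) in the coordinate [w = log z].  The uniqueness
    of Fourier coefficients, and the orthogonality of functions with disjoint
    spectra ([disjoint_spectra]), come from a positive trigonometric kernel
    ([kernel_approximation]).

    The same variance argument shows that a constant product has constant factors: if
    [theta] is a unimodular constant, the means of [theta1] and [theta2] have modulus at
    most [1] and product of modulus [1] ([constant_inner_product_constant]). *)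

(** * Goursat's theorem for rectangles *)

Section IteratedIntegrals.
Variable R : realType.
Implicit Types (f : R -> R) (P Q : R -> R -> R).

Lemma continuous_itv_integrable f (a b : R) :
  (forall x, a <= x <= b -> {for x, continuous f}) ->
  (@lebesgue_measure R).-integrable `[a, b] (EFin \o f).
Proof.
move=> cf; apply: continuous_compact_integrable; first exact: segment_compact.
by apply: continuous_in_subspaceT => x; rewrite inE/= in_itv/=; exact: cf.
Qed.

Lemma cst_itv_integrable (k a b : R) :
  (@lebesgue_measure R).-integrable `[a, b] (EFin \o cst k).
Proof. by apply: continuous_itv_integrable => x _; exact: cst_continuous. Qed.

Lemma Rintegral_itv_split f (a m b : R) :
  (@lebesgue_measure R).-integrable `[a, b] (EFin \o f) -> a <= m -> m <= b ->
  \int[@lebesgue_measure R]_(t in `[a, b]) f t =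
  \int[@lebesgue_measure R]_(t in `[a, m]) f t +
  \int[@lebesgue_measure R]_(t in `[m, b]) f t.
Proof.
move=> fi am mb; have := @Rintegral_itvB R f (BLeft a) (BRight b) m fi.
rewrite !bnd_simp => /(_ am mb); rewrite Rintegral_itv_obnd_cbnd; first by lra.
apply: integrableS fi => //.
by apply: subset_itvr; rewrite bnd_simp.
Qed.

Lemma lebesgue_itv (a b : R) : a <= b ->
  fine (@lebesgue_measure R `[a, b]) = b - a.
Proof.
move=> ab; rewrite lebesgue_measure_itv/= lte_fin.
by case: ltgtP ab => // -> _; rewrite subrr.
Qed.

Lemma Rintegral_near_const f (a b k e : R) :
  (@lebesgue_measure R).-integrable `[a, b] (EFin \o f) -> a <= b ->
  (forall t, a <= t <= b -> `|f t - k| <= e) ->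
  `|\int[@lebesgue_measure R]_(t in `[a, b]) f t - k * (b - a)| <= e * (b - a).
Proof.
move=> fi ab h; rewrite -(lebesgue_itv ab) -!Rintegral_cst//.
rewrite -RintegralB//; last exact: cst_itv_integrable.
have fki : (@lebesgue_measure R).-integrable `[a, b] (EFin \o (fun t => f t - k)).
  rewrite (_ : _ \o _ = ((EFin \o f) \- (EFin \o cst k))%E)//.
  by apply: integrableB => //; exact: cst_itv_integrable.
apply: (le_trans (le_normr_Rintegral _ fki)) => //.
apply: le_Rintegral => //.
- exact: integrable_norm.
- exact: cst_itv_integrable.
Qed.

Lemma nested_intervals (l r : nat -> R) :
  (forall n, l n <= l n.+1) -> (forall n, r n.+1 <= r n) ->
  (forall n, l n <= r n) -> exists x, forall n, l n <= x <= r n.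
Proof.
move=> ll rr lr.
have ln i j : (i <= j)%N -> l i <= l j by move/(homo_leq (@lexx _ R) (@le_trans _ R) ll).
have rn i j : (i <= j)%N -> r j <= r i.
  move=> ij; rewrite -lerN2.
  have rr' n : - r n <= - r n.+1 by rewrite lerN2.
  by have /(_ _ _ ij) := @homo_leq R (fun n => - r n) <=%R (@lexx _ R) (@le_trans _ R) rr'.
have lrn i j : l i <= r j.
  case: (leqP i j) => ij; first exact: le_trans (ln _ _ ij) (lr j).
  by apply: (le_trans (lr i)); apply: rn; exact: ltnW.
have hs : has_sup (range l).
  split; first by exists (l 0%N); exists 0%N.
  by exists (r 0%N) => _ [i _ <-].
exists (sup (range l)) => n; apply/andP; split.
  by apply: sup_upper_bound => //; exists n.
by apply: ge_sup; [case: hs|move=> _ [i _ <-]].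
Qed.

(** The integral of the one-form [P ds + Q dt] over the boundary of the rectangle
    [[a, b] x [c, d]], counterclockwise. *)
Definition circulation P Q (a b c d : R) : R :=
  \int[@lebesgue_measure R]_(t in `[c, d]) (Q b t - Q a t) -
  \int[@lebesgue_measure R]_(s in `[a, b]) (P s d - P s c).

(** The one-form [P ds + Q dt] has zero exterior derivative at the point, [A] being the
    common value of [dQ/ds] and [dP/dt].  Differentiability is a pointwise condition
    here, because the derivative of a holomorphic function is not known beforehand
    to be continuous. *)
Definition closed_at P Q (s0 t0 : R) : Prop :=
  exists A B C : R, forall e : R, 0 < e -> exists2 d : R, 0 < d &
    forall s t, `|s - s0| < d -> `|t - t0| < d ->
      `|Q s t - Q s0 t0 - (A * (s - s0) + B * (t - t0))| <=
         e * (`|s - s0| + `|t - t0|) /\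
      `|P s t - P s0 t0 - (C * (s - s0) + A * (t - t0))| <=
         e * (`|s - s0| + `|t - t0|).

Lemma linear_bound_continuous f (x0 k : R) :
  (exists2 d : R, 0 < d & forall x, `|x - x0| < d -> `|f x - f x0| <= k * `|x - x0|) ->
  {for x0, continuous f}.
Proof.
move=> [d d0 h]; apply/cvgrPdist_lt => e e0.
have k0 : 0 < `|k| + 1 by rewrite ltr_pwDr.
near=> x.
have xd : `|x - x0| < Num.min d (e / (`|k| + 1)).
  near: x; apply/nbhs_ballP; exists (Num.min d (e / (`|k| + 1))) => /=.
    by rewrite lt_min d0 divr_gt0.
  by move=> y; rewrite /ball/= distrC.
move: xd; rewrite lt_min => /andP[xd xe].
rewrite distrC; apply: (le_lt_trans (h _ xd)).
apply: (@le_lt_trans _ _ (`|k| * `|x - x0|)); first by rewrite ler_wpM2r// ler_norm.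
apply: (@le_lt_trans _ _ ((`|k| + 1) * `|x - x0|)); first by rewrite ler_wpM2r// lerDl.
by rewrite mulrC -ltr_pdivlMr.
Unshelve. all: by end_near. Qed.

Lemma closed_at_continuous P Q s0 t0 : closed_at P Q s0 t0 ->
  [/\ {for t0, continuous (Q s0)}, {for t0, continuous (P s0)},
      {for s0, continuous (Q ^~ t0)} & {for s0, continuous (P ^~ t0)}].
Proof.
move=> [A [B [C /(_ 1 ltr01) [d d0 h]]]].
have key (u v k : R) : `|u - k * v| <= 1 * `|v| -> `|u| <= (`|k| + 1) * `|v|.
  move=> uv; rewrite mulrDl mul1r -normrM.
  have -> : u = k * v + (u - k * v) by ring.
  by apply: (le_trans (ler_normD _ _)); rewrite lerD2l -[leRHS]mul1r.
split; [apply: (@linear_bound_continuous _ _ (`|B| + 1))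
      |apply: (@linear_bound_continuous _ _ (`|A| + 1))
      |apply: (@linear_bound_continuous _ _ (`|A| + 1))
      |apply: (@linear_bound_continuous _ _ (`|C| + 1))];
  exists d => // x xd; apply: key.
- by have [] := h s0 x; rewrite ?subrr ?normr0 ?mulr0 ?add0r ?addr0.
- by have [] := h s0 x; rewrite ?subrr ?normr0 ?mulr0 ?add0r ?addr0.
- by have [] := h x t0; rewrite ?subrr ?normr0 ?mulr0 ?add0r ?addr0.
- by have [] := h x t0; rewrite ?subrr ?normr0 ?mulr0 ?add0r ?addr0.
Qed.

Section Goursat.
Variables (P Q : R -> R -> R) (S : R).
Hypothesis PQ : forall s t, s < S -> closed_at P Q s t.

Let iQ s s' c d : s < S -> s' < S ->
  (@lebesgue_measure R).-integrable `[c, d] (EFin \o (fun t => Q s t - Q s' t)).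
Proof.
move=> sS sS'; apply: continuous_itv_integrable => t _.
by apply: continuousB; [case: (closed_at_continuous (PQ t sS))|
                        case: (closed_at_continuous (PQ t sS'))].
Qed.

Let iP t t' a b : b < S ->
  (@lebesgue_measure R).-integrable `[a, b] (EFin \o (fun s => P s t - P s t')).
Proof.
move=> bS; apply: continuous_itv_integrable => s /andP[_ sb].
have sS := le_lt_trans sb bS.
by apply: continuousB; [case: (closed_at_continuous (PQ t sS))|
                        case: (closed_at_continuous (PQ t' sS))].
Qed.

Lemma circulation_split_s a m b c d : a <= m -> m <= b -> b < S ->
  circulation P Q a b c d = circulation P Q a m c d + circulation P Q m b c d.
Proof.
move=> am mb bS; have mS := le_lt_trans mb bS; have aS := le_lt_trans am mS.
rewrite /circulation (Rintegral_itv_split (iP d c a bS) am mb).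
have -> : \int[@lebesgue_measure R]_(t in `[c, d]) (Q b t - Q a t) =
    \int[@lebesgue_measure R]_(t in `[c, d]) (Q m t - Q a t) +
    \int[@lebesgue_measure R]_(t in `[c, d]) (Q b t - Q m t).
  rewrite -RintegralD//; try exact: iQ.
  by apply: eq_Rintegral => t _; ring.
ring.
Qed.

Lemma circulation_split_t a b c m d : a <= b -> c <= m -> m <= d -> b < S ->
  circulation P Q a b c d = circulation P Q a b c m + circulation P Q a b m d.
Proof.
move=> ab cm md bS; have aS := le_lt_trans ab bS.
rewrite /circulation (Rintegral_itv_split (iQ c d bS aS) cm md).
have -> : \int[@lebesgue_measure R]_(s in `[a, b]) (P s d - P s c) =
    \int[@lebesgue_measure R]_(s in `[a, b]) (P s m - P s c) +
    \int[@lebesgue_measure R]_(s in `[a, b]) (P s d - P s m).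
  rewrite -RintegralD//; try exact: iP.
  by apply: eq_Rintegral => t _; ring.
ring.
Qed.

(** Around a point where the form is closed the affine part of [(P, Q)] has zero
    circulation, so only the remainder counts: it is small compared with
    the perimeter times the diameter. *)
Lemma circulation_small s0 t0 e : s0 < S -> 0 < e -> exists2 d : R, 0 < d &
  forall x y w h, 0 <= w -> 0 <= h -> w < d -> h < d -> x + w < S ->
    x <= s0 <= x + w -> y <= t0 <= y + h ->
    `|circulation P Q x (x + w) y (y + h)| <= e * (w + h) ^+ 2.
Proof.
move=> s0S e0; have [A [B [C /(_ (e / 2)) []]]] := PQ t0 s0S; first by rewrite divr_gt0.
move=> d d0 H; exists d => // x y w h w0 h0 wd hd xwS xs yt.
have in_d (z k u v : R) : z <= u <= z + k -> z <= v <= z + k -> `|v - u| <= k.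
  by move=> /andP[? ?] /andP[? ?]; rewrite ler_norml; lra.
have est s t : x <= s <= x + w -> y <= t <= y + h ->
    `|Q s t - Q s0 t0 - (A * (s - s0) + B * (t - t0))| <= e / 2 * (w + h) /\
    `|P s t - P s0 t0 - (C * (s - s0) + A * (t - t0))| <= e / 2 * (w + h).
  move=> hs ht; have hs' := in_d _ _ _ _ xs hs; have ht' := in_d _ _ _ _ yt ht.
  have [] := H s t; [exact: le_lt_trans hs' wd|exact: le_lt_trans ht' hd|].
  move=> h1 h2; split; [apply: le_trans h1 _|apply: le_trans h2 _];
    by rewrite ler_wpM2l ?lerD// divr_ge0// ltW.
have xw : x <= x <= x + w by rewrite lexx lerDl.
have xw' : x <= x + w <= x + w by rewrite lexx lerDl w0.
have yh : y <= y <= y + h by rewrite lexx lerDl.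
have yh' : y <= y + h <= y + h by rewrite lexx lerDl h0.
have I1 : `|\int[@lebesgue_measure R]_(t in `[y, y + h]) (Q (x + w) t - Q x t) -
    A * w * (y + h - y)| <= e * (w + h) * (y + h - y).
  apply: Rintegral_near_const => //; [|by rewrite lerDl|].
    by apply: iQ => //; apply: le_lt_trans xwS; rewrite lerDl.
  move=> t ht; have [h1 _] := est _ t xw ht; have [h2 _] := est _ t xw' ht.
  by move: h1 h2; rewrite !ler_norml; lra.
have I2 : `|\int[@lebesgue_measure R]_(s in `[x, x + w]) (P s (y + h) - P s y) -
    A * h * (x + w - x)| <= e * (w + h) * (x + w - x).
  apply: Rintegral_near_const => //; [exact: iP|by rewrite lerDl|].
  move=> s hs; have [_ h1] := est s _ hs yh; have [_ h2] := est s _ hs yh'.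
  by move: h1 h2; rewrite !ler_norml; lra.
rewrite /circulation; move: I1 I2.
set I := Rintegral _ _ _; set J := Rintegral _ _ _; rewrite !ler_norml.
move=> /andP[I1 I1'] /andP[J1 J1']; apply/andP; split; lra.
Qed.

(** Goursat's argument: if the circulation were not zero, one of the four quarters of the
    rectangle would carry at least a fourth of it, and so on down to a point where
    the circulation is small compared with the area. *)
Theorem circulation_eq0 a b c d : a <= b -> c <= d -> b < S -> circulation P Q a b c d = 0.
Proof.
move=> ab cd bS; set W := b - a; set H := d - c.
have W0 : 0 <= W by rewrite subr_ge0.
have H0 : 0 <= H by rewrite subr_ge0.
pose w n : R := W / 2 ^+ n; pose h n : R := H / 2 ^+ n.
have wS n : w n = w n.+1 + w n.+1 by rewrite /w exprS; field.
have hS n : h n = h n.+1 + h n.+1 by rewrite /h exprS; field.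
have w0 n : 0 <= w n by rewrite divr_ge0// exprn_ge0.
have h0 n : 0 <= h n by rewrite divr_ge0// exprn_ge0.
pose cr n (z : R * R) := circulation P Q z.1 (z.1 + w n) z.2 (z.2 + h n).
pose quarter n (z z' : R * R) := [/\ z.1 <= z'.1 <= z.1 + w n.+1,
  z.2 <= z'.2 <= z.2 + h n.+1 & `|cr n z| <= 4 * `|cr n.+1 z'|].
have ex_quarter n z : z.1 + w n < S -> exists z', quarter n z z'.
  case: z => x y /= xS.
  have e1 : cr n (x, y) = cr n.+1 (x, y) + cr n.+1 (x, y + h n.+1) +
      (cr n.+1 (x + w n.+1, y) + cr n.+1 (x + w n.+1, y + h n.+1)).
    rewrite /cr /= (@circulation_split_s x (x + w n.+1)); last 3 first.
    - by rewrite lerDl.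
    - by rewrite (wS n) addrA lerDl.
    - by [].
    move: xS; rewrite (hS n) (wS n) (addrA x) (addrA y) => xS.
    congr (_ + _); apply: circulation_split_t; rewrite ?lerDl//.
    by apply: le_lt_trans xS; rewrite lerDl.
  (* Otherwise each of the four quarters would carry less than a fourth. *)
  apply: contrapT => /forallNP no.
  have lt4 (z' : R * R) : x <= z'.1 <= x + w n.+1 -> y <= z'.2 <= y + h n.+1 ->
      4 * `|cr n.+1 z'| < `|cr n (x, y)|.
    move=> hx hy; rewrite ltNge; apply/negP => le4; apply: (no z'); split => //.
  have xx : x <= x <= x + w n.+1 by rewrite lexx lerDl w0.
  have xx' : x <= x + w n.+1 <= x + w n.+1 by rewrite lexx lerDl w0.
  have yy : y <= y <= y + h n.+1 by rewrite lexx lerDl h0.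
  have yy' : y <= y + h n.+1 <= y + h n.+1 by rewrite lexx lerDl h0.
  have := lt4 (x, y) xx yy; have := lt4 (x, y + h n.+1) xx yy'.
  have := lt4 (x + w n.+1, y) xx' yy; have := lt4 (x + w n.+1, y + h n.+1) xx' yy'.
  have tri (p q r s : R) : `|p + q + (r + s)| <= `|p| + `|q| + (`|r| + `|s|).
    by apply: (le_trans (ler_normD _ _)); rewrite lerD// ler_normD.
  rewrite e1; have := tri (cr n.+1 (x, y)) (cr n.+1 (x, y + h n.+1))
    (cr n.+1 (x + w n.+1, y)) (cr n.+1 (x + w n.+1, y + h n.+1)).
  by lra.
pose fix corner n : R * R :=
  if n is m.+1 then xget (corner m) [set z | quarter m (corner m) z] else (a, c).
have step n : (corner n).1 + w n < S -> quarter n (corner n) (corner n.+1).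
  move=> cS; have [z hz] := ex_quarter n _ cS.
  by rewrite /=; case: xgetP => [? _ //|/(_ z)].
have cornerS n : (corner n).1 + w n < S.
  elim: n => [|n IH]; first by rewrite /= /w /W expr0 divr1 addrC subrK.
  have [/andP[_ ?] _ _] := step n IH.
  by apply: le_lt_trans IH; rewrite (wS n) addrA lerD2r.
have cornerP n := step n (cornerS n).
have [s0 hs0] : exists s, forall n, (corner n).1 <= s <= (corner n).1 + w n.
  apply: (@nested_intervals (fun n => (corner n).1) (fun n => (corner n).1 + w n)) => n.
  - by have [/andP[]] := cornerP n.
  - by have [/andP[_ ?] _ _] := cornerP n; rewrite (wS n) addrA lerD2r.
  - by rewrite lerDl.
have [t0 ht0] : exists t, forall n, (corner n).2 <= t <= (corner n).2 + h n.
  apply: (@nested_intervals (fun n => (corner n).2) (fun n => (corner n).2 + h n)) => n.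
  - by have [_ /andP[]] := cornerP n.
  - by have [_ /andP[_ ?] _] := cornerP n; rewrite (hS n) addrA lerD2r.
  - by rewrite lerDl.
have crn n : `|circulation P Q a b c d| <= 4 ^+ n * `|cr n (corner n)|.
  elim: n => [|n IH].
    by rewrite expr0 mul1r /cr /= /w /h expr0 !divr1 /W /H ![_ + (_ - _)]addrC !subrK.
  apply: (le_trans IH); have [_ _ le4] := cornerP n.
  by rewrite exprSr -mulrA ler_wpM2l// exprn_ge0.
apply/eqP; rewrite -normr_eq0 eq_le normr_ge0 andbT.
apply/ler_addgt0Pr => e e0; rewrite add0r.
have W1 : 0 < (W + H) ^+ 2 + 1 by rewrite ltr_pwDr// exprn_ge0// addr_ge0.
have s0S : s0 < S by have /andP[_ ?] := hs0 0%N; apply: le_lt_trans (cornerS 0%N).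
have [dl dl0 small] := @circulation_small s0 t0 (e / ((W + H) ^+ 2 + 1)) s0S (divr_gt0 e0 W1).
have [n [wn hn]] : exists n, w n < dl /\ h n < dl.
  have c2 (k : R) : (k / 2 ^+ n @[n --> \oo] --> (0 : R)).
    have := @cvg_geometric R k (1 / 2); rewrite /geometric /= => h2.
    apply: cvg_trans (h2 _); last by rewrite ger0_norm; lra.
    by apply: near_eq_cvg; apply: nearW => n; rewrite expr_div_n expr1n mul1r.
  have := c2 W; have := c2 H; move=> /cvgrPdist_lt /(_ _ dl0) hH /cvgrPdist_lt /(_ _ dl0) hW.
  have : \forall n \near \oo, w n < dl /\ h n < dl.
    near=> n; split.
      have : `|0 - W / 2 ^+ n| < dl by near: n.
      by rewrite sub0r normrN ger0_norm// w0.
    have : `|0 - H / 2 ^+ n| < dl by near: n.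
    by rewrite sub0r normrN ger0_norm// h0.
  by move=> [N _ /(_ N (leqnn N))]; exists N.
apply: (le_trans (crn n)).
have := small _ _ _ _ (w0 n) (h0 n) wn hn (cornerS n) (hs0 n) (ht0 n).
move=> /(ler_wpM2l (exprn_ge0 n (ler0n R 4))) /le_trans; apply.
have -> : 4 ^+ n * (e / ((W + H) ^+ 2 + 1) * (w n + h n) ^+ 2) =
   e * ((W + H) ^+ 2 / ((W + H) ^+ 2 + 1)).
  rewrite /w /h -mulrDl expr_div_n -exprM mulnC exprM.
  have -> : (2 : R) ^+ 2 = 4 by ring.
  by field; rewrite lt0r_neq0//= expf_neq0.
rewrite -[leRHS]mulr1 ler_wpM2l// ?(ltW e0)// ler_pdivrMr// mul1r.
by rewrite lerDl.
Unshelve. all: by end_near. Qed.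

End Goursat.
End IteratedIntegrals.

(** * Complex numbers and differentiability *)

Section ComplexBasics.
Variable R : realType.
Implicit Types (z w : R[i]) (F G : R[i] -> R[i]).

Lemma normc_real_norm z : `|z| = (normc z)%:C. Proof. by []. Qed.

Lemma normc_ge0 z : 0 <= normc z.
Proof. by case: z => a b; exact: sqrtr_ge0. Qed.

Lemma normc_sqr z : normc z ^+ 2 = complex.Re z ^+ 2 + complex.Im z ^+ 2.
Proof. by case: z => a b /=; rewrite sqr_sqrtr// addr_ge0// sqr_ge0. Qed.

Lemma Re_le_normc z : `|complex.Re z| <= normc z.
Proof.
rewrite -(@ler_pXn2r _ 2)// ?nnegrE ?normc_ge0//.
by rewrite normc_sqr real_normK ?num_real// lerDl sqr_ge0.
Qed.

Lemma Im_le_normc z : `|complex.Im z| <= normc z.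
Proof.
rewrite -(@ler_pXn2r _ 2)// ?nnegrE ?normc_ge0//.
by rewrite normc_sqr real_normK ?num_real// lerDr sqr_ge0.
Qed.

Lemma normc_le_ReIm z : normc z <= `|complex.Re z| + `|complex.Im z|.
Proof.
rewrite -(@ler_pXn2r _ 2)// ?nnegrE ?normc_ge0 ?addr_ge0//.
rewrite normc_sqr sqrrD !real_normK ?num_real// addrAC lerDl.
by rewrite mulrn_wge0// mulr_ge0.
Qed.

Lemma normcX z n : normc (z ^+ n) = normc z ^+ n.
Proof. by elim: n => [|n IH]; rewrite ?expr0 ?normc1// !exprS normcM IH. Qed.

Lemma normcJ z : normc (conjc z) = normc z.
Proof. by case: z => a b /=; rewrite sqrrN. Qed.

Lemma mulcJ_normc z : z * conjc z = (normc z ^+ 2)%:C.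
Proof.
rewrite normc_sqr; case: z => a b /=; simpc.
by apply/eqP; rewrite eq_complex /=; apply/andP; split; apply/eqP; ring.
Qed.

Lemma complex_eta z : z = (complex.Re z) +i* (complex.Im z).
Proof. by case: z. Qed.

Lemma ReM z w : complex.Re (z * w) =
  complex.Re z * complex.Re w - complex.Im z * complex.Im w.
Proof. by case: z w => [a b] [c d]. Qed.

Lemma ImM z w : complex.Im (z * w) =
  complex.Re z * complex.Im w + complex.Im z * complex.Re w.
Proof. by case: z w => [a b] [c d]. Qed.

Lemma ReD z w : complex.Re (z + w) = complex.Re z + complex.Re w.
Proof. by case: z w => [a b] [c d]. Qed.

Lemma ImD z w : complex.Im (z + w) = complex.Im z + complex.Im w.
Proof. by case: z w => [a b] [c d]. Qed.

Lemma ReN z : complex.Re (- z) = - complex.Re z. Proof. by case: z. Qed.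
Lemma ImN z : complex.Im (- z) = - complex.Im z. Proof. by case: z. Qed.
Lemma ReJ z : complex.Re (conjc z) = complex.Re z. Proof. by case: z. Qed.
Lemma ImJ z : complex.Im (conjc z) = - complex.Im z. Proof. by case: z. Qed.

(** The topology of [R[i]^o] is given by a norm with values in [R[i]]; this is the
    usual characterization by a real [e]. *)
Lemma cvgcP (T : Type) (D : set_system T) (FD : Filter D) (f : T -> R[i]) (l : R[i]) :
  ((f x : R[i]^o) @[x --> D] --> (l : R[i]^o)) <->
  (forall e : R, 0 < e -> \forall x \near D, normc (l - f x) < e).
Proof.
split=> [/cvgrPdist_lt fl e e0|fl].
  have /fl : 0 < e%:C :> R[i] by rewrite ltcR.
  by apply: filterS => x; rewrite normc_real_norm ltcR.
apply/cvgrPdist_lt => e; rewrite ltcE /= => /andP[/eqP e0 e1].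
have := fl _ e1; apply: filterS => x.
by rewrite normc_real_norm (complex_eta e) ltcE /= e0 eqxx.
Qed.

Lemma cvgc_conj (T : Type) (D : set_system T) (FD : Filter D) (f : T -> R[i]) (l : R[i]) :
  ((f x : R[i]^o) @[x --> D] --> (l : R[i]^o)) ->
  ((conjc (f x) : R[i]^o) @[x --> D] --> (conjc l : R[i]^o)).
Proof.
move=> /cvgcP fl; apply/cvgcP => e /fl; apply: filterS => x.
by rewrite -rmorphB normcJ.
Qed.

Lemma cvgc_ReIm (T : Type) (D : set_system T) (FD : Filter D) (f : T -> R[i]) (l : R[i]) :
  ((f x : R[i]^o) @[x --> D] --> (l : R[i]^o)) ->
  (complex.Re (f x) @[x --> D] --> complex.Re l) /\
  (complex.Im (f x) @[x --> D] --> complex.Im l).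
Proof.
move=> /cvgcP fl; split; apply/cvgrPdist_lt => e /fl; apply: filterS => x.
  by apply: le_lt_trans; rewrite -ReN -ReD Re_le_normc.
by apply: le_lt_trans; rewrite -ImN -ImD Im_le_normc.
Qed.

Lemma ReIm_cvgc (T : Type) (D : set_system T) (FD : Filter D) (f : T -> R[i]) (l : R[i]) :
  (complex.Re (f x) @[x --> D] --> complex.Re l) ->
  (complex.Im (f x) @[x --> D] --> complex.Im l) ->
  ((f x : R[i]^o) @[x --> D] --> (l : R[i]^o)).
Proof.
move=> /cvgrPdist_lt fR /cvgrPdist_lt fI; apply/cvgcP => e e0.
have e2 : 0 < e / 2 by rewrite divr_gt0.
near=> x; apply: (le_lt_trans (normc_le_ReIm _)).
rewrite !(ReD, ImD, ReN, ImN) (splitr e); apply: ltrD; near: x.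
  exact: fR.
exact: fI.
Unshelve. all: by end_near. Qed.

End ComplexBasics.

Section FirstOrder.
Variable K : numFieldType.

Lemma is_derive_first_order (f : K^o -> K^o) (z d : K) :
  is_derive (z : K^o) 1 f (d : K^o) ->
  forall e : K, 0 < e -> exists2 r : K, 0 < r &
    forall h : K, `|h| < r -> `|f (h + z) - f z - d * h| <= e * `|h|.
Proof.
move=> [df dE] e e0.
have /cvgrPdist_le /(_ _ e0) : h^-1 *: ((f \o shift z) (h *: 1) - f z) @[h --> 0^'] --> (d : K^o).
  by rewrite -dE; exact: df.
move=> /nbhs_ballP[r /= r0 hr]; exists r => // h hr'.
have [->|h0] := eqVneq h 0.
  by rewrite add0r subrr mulr0 subrr normr0 mulr0.
have := hr h; rewrite /ball /= sub0r normrN => /(_ hr' h0).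
rewrite /= [h *: 1]mulr1 => le_e.
have -> : f (h + z) - f z - d * h = - ((d - h^-1 *: (f (h + z) - f z)) * h).
  by rewrite mulrBl [_ *: _ * h]mulrAC mulVf// mul1r opprB.
by rewrite normrN normrM ler_wpM2r.
Qed.

Lemma first_order_derivable (f : K^o -> K^o) (z d : K) :
  (forall e : K, 0 < e -> exists2 r : K, 0 < r &
    forall h : K, `|h| < r -> `|f (h + z) - f z - d * h| <= e * `|h|) ->
  derivable f z 1.
Proof.
move=> H; apply/cvg_ex; exists d; apply/cvgrPdist_le => e /H[r r0 hr].
apply/nbhs_ballP; exists r => //= h; rewrite /ball /= sub0r normrN => /hr le_e h0.
rewrite [h *: 1]mulr1 -(ler_pM2r (x := `|h|)) ?normr_gt0//.
rewrite -normrM mulrBl [_ *: _ * h]mulrAC mulVf// mul1r -normrN opprB.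
exact: le_e.
Qed.

Lemma derivable_first_order (f : K^o -> K^o) (z : K) : derivable f z 1 ->
  exists d : K, forall e : K, 0 < e -> exists2 r : K, 0 < r &
    forall h : K, `|h| < r -> `|f (h + z) - f z - d * h| <= e * `|h|.
Proof.
by move=> /derivableP df; exists ('D_1 f z); exact: is_derive_first_order.
Qed.

End FirstOrder.

(** * The exponential coordinate *)

Section LogCoordinates.
Variable R : realType.
Implicit Types (z w : R[i]) (F G : R[i] -> R[i]).

Lemma mul_real_complex (x y : R) : x%:C * y%:C = (x * y)%:C.
Proof. by simpc. Qed.

Lemma polarM (r r' s t : R) : polar r s * polar r' t = polar (r * r') (s + t).
Proof.
rewrite /polar cosD sinD; simpc.
by apply/eqP; rewrite eq_complex /=; apply/andP; split; apply/eqP; ring.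
Qed.

Lemma polar10 : polar 1 0 = 1 :> R[i].
Proof. by rewrite /polar cos0 sin0 mulr1 mulr0. Qed.

Lemma normc_polar (r t : R) : 0 <= r -> normc (polar r t) = r.
Proof.
move=> r0; apply/eqP; rewrite -(@eqrXn2 _ 2)// ?normc_ge0//.
rewrite normc_sqr /= !exprMn -mulrDr cos2Dsin2 mulr1.
by [].
Qed.

Lemma conjc_polar (r t : R) : conjc (polar r t) = polar r (- t).
Proof. by rewrite /polar cosN sinN mulrN. Qed.

Lemma polar1_conj (t : R) : polar 1 t * conjc (polar 1 t) = 1.
Proof. by rewrite conjc_polar polarM mulr1 subrr polar10. Qed.

Lemma polar_scale (r t : R) : polar r t = r%:C * polar 1 t.
Proof. by rewrite /polar !mul1r; simpc. Qed.

Lemma polar_periodic (r t : R) : polar r (t + 2 * pi) = polar r t.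
Proof. by rewrite /polar mulr_natl cosD2pi sinD2pi. Qed.

Definition expc w : R[i] := polar (expR (complex.Re w)) (complex.Im w).

Lemma expcD z w : expc (z + w) = expc z * expc w.
Proof. by rewrite /expc polarM -expRD ReD ImD. Qed.

Lemma normc_expc w : normc (expc w) = expR (complex.Re w).
Proof. by rewrite normc_polar// expR_ge0. Qed.

(** Near the origin [expc h - 1 - h] splits into products of remainders of the real
    exponential, cosine and sine. *)
Lemma expc_first_order (e : R) : 0 < e -> exists2 r : R, 0 < r &
  forall h : R[i], normc h < r -> normc (expc h - 1 - h) <= e * normc h.
Proof.
move=> e0; have [k [k0 k1 ke]] : exists k : R, [/\ 0 < k, k <= 1 & k <= e / 8].
  by exists (Num.min 1 (e / 8)); rewrite lt_min ltr01 divr_gt0//= !ge_min !lexx orbT.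
have [a a0 ha] := is_derive_first_order (is_derive_expR (0 : R)) k0.
have [b b0 hb] := is_derive_first_order (is_derive_cos (0 : R)) k0.
have [c c0 hc] := is_derive_first_order (is_derive_sin (0 : R)) k0.
exists (Num.min k (Num.min a (Num.min b c))).
  by rewrite !lt_min k0 a0 b0 c0.
move=> h; rewrite !lt_min => /andP[hk /andP[ha' /andP[hb' hc']]].
move: (Re_le_normc h) (Im_le_normc h); set N := normc h in hk ha' hb' hc' *.
set x := complex.Re h; set y := complex.Im h => xN yN.
have := ha x (le_lt_trans xN ha'); rewrite addr0 expR0 mul1r.
have := hb y (le_lt_trans yN hb'); rewrite addr0 cos0 sin0 oppr0 mul0r subr0.
have := hc y (le_lt_trans yN hc'); rewrite addr0 cos0 sin0 subr0 mul1r.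
move=> hs hcos hexp.
have Re_e : complex.Re (expc h - 1 - h) =
    (expR x - 1 - x) * cos y + (1 + x) * (cos y - 1).
  by rewrite !(ReD, ReN) /expc /= -/x -/y; ring.
have Im_e : complex.Im (expc h - 1 - h) = (expR x - 1) * sin y + (sin y - y).
  by rewrite !(ImD, ImN) /expc /= -/x -/y; ring.
apply: (le_trans (normc_le_ReIm _)); rewrite Re_e Im_e.
have N0 : 0 <= N by exact: normc_ge0.
have b1 : `|(expR x - 1 - x) * cos y| <= k * N.
  rewrite normrM -[leRHS]mulr1 ler_pM//; last exact: cos_max.
  by apply: (le_trans hexp); rewrite ler_wpM2l// ltW.
have b2 : `|(1 + x) * (cos y - 1)| <= 2 * (k * N).
  rewrite normrM ler_pM//.
    have := ler_normD 1 x; rewrite normr1; lra.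
  by apply: (le_trans hcos); rewrite ler_wpM2l// ltW.
have kx : k * `|x| <= `|x| by rewrite ler_piMl.
have ky : k * `|y| <= `|y| by rewrite ler_piMl.
have b3 : `|(expR x - 1) * sin y| <= (2 * k) * (2 * N).
  rewrite normrM ler_pM//.
    have := ler_normD (expR x - 1 - x) x; rewrite subrK; lra.
  have := ler_normD (sin y - y) y; rewrite subrK; lra.
have b4 : `|sin y - y| <= k * N.
  by apply: (le_trans hs); rewrite ler_wpM2l// ltW.
have := ler_normD ((expR x - 1 - x) * cos y) ((1 + x) * (cos y - 1)).
have := ler_normD ((expR x - 1) * sin y) (sin y - y).
have : k * N <= e / 8 * N by rewrite ler_wpM2r.
lra.
Qed.

Lemma derivable_expc w : derivable (expc : R[i]^o -> R[i]^o) w 1.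
Proof.
apply: (@first_order_derivable _ _ _ (expc w)) => e.
rewrite ltcE /= => /andP[/eqP e0 e1].
have W0 : 0 < normc (expc w) by rewrite normc_expc expR_gt0.
have [r r0 hr] := expc_first_order (divr_gt0 e1 W0).
exists (r%:C); first by rewrite ltcR.
move=> h; rewrite normc_real_norm ltcR => /hr le_e.
rewrite normc_real_norm (complex_eta e) e0 complexr0 -[X in _ <= _ * X]/((normc h)%:C).
rewrite mul_real_complex lecR expcD.
have -> : expc h * expc w - expc w - expc w * h = expc w * (expc h - 1 - h) by ring.
by rewrite normcM mulrC -ler_pdivlMr// mulrAC.
Qed.

Lemma derivable_closed_at G (s0 t0 : R) :
  derivable (G : R[i]^o -> R[i]^o) (s0 +i* t0) 1 ->
  closed_at (fun s t => complex.Im (G (s +i* t))) (fun s t => complex.Re (G (s +i* t))) s0 t0 /\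
  closed_at (fun s t => - complex.Re (G (s +i* t))) (fun s t => complex.Im (G (s +i* t))) s0 t0.
Proof.
move=> /derivable_first_order [d hd].
have H (e : R) : 0 < e -> exists2 r : R, 0 < r & forall s t,
    `|s - s0| < r -> `|t - t0| < r ->
    `|complex.Re (G (s +i* t)) - complex.Re (G (s0 +i* t0)) -
       (complex.Re d * (s - s0) - complex.Im d * (t - t0))| <= e * (`|s - s0| + `|t - t0|) /\
    `|complex.Im (G (s +i* t)) - complex.Im (G (s0 +i* t0)) -
       (complex.Im d * (s - s0) + complex.Re d * (t - t0))| <= e * (`|s - s0| + `|t - t0|).
  move=> e0; have /hd[r] : 0 < e%:C :> R[i] by rewrite ltcR.
  rewrite ltcE /= => /andP[/eqP r0 r1] hr; exists (complex.Re r / 2); first by rewrite divr_gt0.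
  move=> s t hs ht; pose h : R[i] := (s - s0) +i* (t - t0).
  have hN : normc h <= `|s - s0| + `|t - t0| by exact: normc_le_ReIm.
  have := hr h; rewrite normc_real_norm (complex_eta r) r0 complexr0 ltcR.
  have -> : h + (s0 +i* t0) = s +i* t by rewrite /h; simpc; rewrite !subrK.
  move=> /(_ (le_lt_trans hN _)); rewrite (splitr (complex.Re r)) => /(_ (ltrD hs ht)).
  rewrite normc_real_norm -[X in _ <= _ * X]/((normc h)%:C) mul_real_complex lecR => le_e.
  have le_e' := le_trans le_e (ler_wpM2l (ltW e0) hN).
  split; apply: le_trans le_e'.
    by apply: le_trans (Re_le_normc _); rewrite !(ReD, ReN, ReM) /=.
  apply: le_trans (Im_le_normc _); rewrite le_eqVlt; apply/orP; left; apply/eqP.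
  by congr `|_|; rewrite !(ImD, ImN, ImM) /=; ring.
split.
  exists (complex.Re d), (- complex.Im d), (complex.Im d) => e /H[r r0 hr]; exists r => // s t hs ht.
  have [h1 h2] := hr s t hs ht; split; last exact: h2.
  by rewrite mulNr.
exists (complex.Im d), (complex.Re d), (- complex.Re d) => e /H[r r0 hr]; exists r => // s t hs ht.
have [h1 h2] := hr s t hs ht; split; first exact: h2.
apply: le_trans h1; rewrite le_eqVlt -normrN; apply/orP; left; apply/eqP.
by congr `|_|; ring.
Qed.

End LogCoordinates.

(** * Integrals over the circle *)

Section CircleIntegrals.
Variable R : realType.
Local Notation mu := (@lebesgue_measure R).
Implicit Types (f g h : R -> R[i]) (u v : R -> R).

Lemma measurable_angles : measurable (@angles R).
Proof. exact: measurable_itv. Qed.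
#[local] Hint Resolve measurable_angles : core.

Lemma angles_length : fine (mu (@angles R)) = 2 * pi.
Proof. by rewrite lebesgue_itv ?subr0// mulr_ge0// pi_ge0. Qed.

Lemma ae_circle_all (p : R -> Prop) : (forall t, angles t -> p t) -> ae_circle p.
Proof. by move=> pt; apply: aeW => t at_; exact: pt. Qed.

Lemma ae_circleS (p q : R -> Prop) : (forall t, angles t -> p t -> q t) ->
  ae_circle p -> ae_circle q.
Proof.
move=> pq; apply: (@filterS _ _ (ae_filter_ringOfSetsType mu)).
by move=> t pt at_; apply: pq => //; exact: pt.
Qed.

Lemma ae_circleS2 (p q r : R -> Prop) :
  (forall t, angles t -> p t -> q t -> r t) ->
  ae_circle p -> ae_circle q -> ae_circle r.
Proof.
move=> pqr; apply: (@filterS2 _ _ (ae_filter_ringOfSetsType mu)).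
by move=> t pt qt at_; apply: pqr => //; [exact: pt|exact: qt].
Qed.

Lemma ae_circle_neq (t0 : R) : ae_circle (fun t => t <> t0).
Proof.
exists [set t0]; split => //; first by rewrite lebesgue_measure_set1.
by move=> t /= /not_implyP[_ /contrapT].
Qed.

Lemma measurable_circle_cst (c : R[i]) : measurable_circle (fun=> c).
Proof. by split; exact: measurable_cst. Qed.

Lemma measurable_circleM f g : measurable_circle f -> measurable_circle g ->
  measurable_circle (fun t => f t * g t).
Proof.
move=> [fR fI] [gR gI]; split.
  under eq_fun do rewrite ReM.
  by apply: measurable_funB; apply: measurable_funM.
under eq_fun do rewrite ImM.
by apply: measurable_funD; apply: measurable_funM.
Qed.

Lemma measurable_circleD f g : measurable_circle f -> measurable_circle g ->
  measurable_circle (fun t => f t + g t).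
Proof.
move=> [fR fI] [gR gI]; split.
  by under eq_fun do rewrite ReD; exact: measurable_funD.
by under eq_fun do rewrite ImD; exact: measurable_funD.
Qed.

Lemma measurable_circleN f : measurable_circle f ->
  measurable_circle (fun t => - f t).
Proof.
move=> [fR fI]; split.
  by under eq_fun do rewrite ReN; exact: measurable_funN.
by under eq_fun do rewrite ImN; exact: measurable_funN.
Qed.

Lemma measurable_circleJ f : measurable_circle f ->
  measurable_circle (fun t => conjc (f t)).
Proof.
move=> [fR fI]; split.
  by under eq_fun do rewrite ReJ.
by under eq_fun do rewrite ImJ; exact: measurable_funN.
Qed.

Lemma measurable_circleX f n : measurable_circle f ->
  measurable_circle (fun t => f t ^+ n).
Proof.
move=> mf; elim: n => [|n IH].
  by under eq_fun do rewrite expr0; exact: measurable_circle_cst.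
by under eq_fun do rewrite exprS; exact: measurable_circleM.
Qed.

Definition integrable_circle f : Prop :=
  mu.-integrable (@angles R) (EFin \o (fun t => complex.Re (f t))) /\
  mu.-integrable (@angles R) (EFin \o (fun t => complex.Im (f t))).

Lemma integrable_circle_measurable f : integrable_circle f -> measurable_circle f.
Proof. by move=> [fR fI]; split; apply/measurable_EFinP; exact: (measurable_int mu). Qed.

Lemma integrable_realD u v : mu.-integrable (@angles R) (EFin \o u) ->
  mu.-integrable (@angles R) (EFin \o v) ->
  mu.-integrable (@angles R) (EFin \o (fun t => u t + v t)).
Proof.
move=> iu iv; rewrite (_ : _ \o _ = ((EFin \o u) \+ (EFin \o v))%E)//.
exact: integrableD.
Qed.

Lemma integrable_realZ (k : R) u : mu.-integrable (@angles R) (EFin \o u) ->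
  mu.-integrable (@angles R) (EFin \o (fun t => k * u t)).
Proof.
move=> iu; rewrite (_ : _ \o _ = (fun t => k%:E * (EFin \o u) t)%E)//.
exact: integrableZl.
Qed.

Lemma integrable_circleD f g : integrable_circle f -> integrable_circle g ->
  integrable_circle (fun t => f t + g t).
Proof.
move=> [fR fI] [gR gI]; split.
  by under eq_fun do rewrite ReD; exact: integrable_realD.
by under eq_fun do rewrite ImD; exact: integrable_realD.
Qed.

Lemma integrable_circleZ (c : R[i]) f : integrable_circle f ->
  integrable_circle (fun t => c * f t).
Proof.
move=> [fR fI]; split.
  under eq_fun do rewrite ReM -mulNr.
  by apply: integrable_realD; exact: integrable_realZ.
under eq_fun do rewrite ImM.
by apply: integrable_realD; exact: integrable_realZ.
Qed.

Lemma integrable_circleJ f : integrable_circle f ->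
  integrable_circle (fun t => conjc (f t)).
Proof.
move=> [fR fI]; split.
  by under eq_fun do rewrite ReJ.
by under eq_fun do rewrite ImJ -mulN1r; exact: integrable_realZ.
Qed.

Lemma integral_circleD f g : integrable_circle f -> integrable_circle g ->
  integral_circle (fun t => f t + g t) = integral_circle f + integral_circle g.
Proof.
move=> [fR fI] [gR gI]; rewrite /integral_circle; simpc.
congr (_ +i* _); rewrite -RintegralD//.
  by apply: eq_Rintegral => t _; rewrite ReD.
by apply: eq_Rintegral => t _; rewrite ImD.
Qed.

Lemma integral_circleZ (c : R[i]) f : integrable_circle f ->
  integral_circle (fun t => c * f t) = c * integral_circle f.
Proof.
move=> [fR fI]; rewrite /integral_circle; case: c => a b; simpc.
have iZ k u : mu.-integrable (@angles R) (EFin \o u) -> k * \int[mu]_(t in @angles R) u t =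
    \int[mu]_(t in @angles R) (k * u t) by move=> iu; rewrite RintegralZl.
rewrite !iZ// -RintegralB ?integrable_realZ// -RintegralD ?integrable_realZ//.
by congr (_ +i* _); apply: eq_Rintegral => t _; rewrite ?ReM ?ImM.
Qed.

Lemma integral_circleB f g : integrable_circle f -> integrable_circle g ->
  integral_circle (fun t => f t - g t) = integral_circle f - integral_circle g.
Proof.
move=> fi gi; have -> : (fun t => f t - g t) = (fun t => f t + (-1) * g t).
  by apply/funext => t; rewrite mulN1r.
by rewrite integral_circleD ?integral_circleZ ?mulN1r//; exact: integrable_circleZ.
Qed.

Lemma integral_circleJ f : integrable_circle f ->
  integral_circle (fun t => conjc (f t)) = conjc (integral_circle f).
Proof.
move=> [fR fI]; rewrite /integral_circle /=; congr (_ +i* _).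
  by apply: eq_Rintegral => t _; rewrite ReJ.
rewrite -mulN1r -RintegralZl//.
by apply: eq_Rintegral => t _; rewrite ImJ mulN1r.
Qed.

Lemma integral_circle_cst (c : R[i]) :
  integral_circle (fun=> c) = (2 * pi)%:C * c.
Proof.
rewrite /integral_circle !Rintegral_cst// angles_length.
by case: c => a b /=; simpc; rewrite ![_ * (2 * pi)]mulrC.
Qed.

Lemma integrable_circle_cst (c : R[i]) : integrable_circle (fun=> c).
Proof. by split; exact: cst_itv_integrable. Qed.

Lemma integral_circle0 : integral_circle (fun=> 0 : R[i]) = 0.
Proof. by rewrite integral_circle_cst mulr0. Qed.

Lemma eq_integral_circle f g : (forall t, angles t -> f t = g t) ->
  integral_circle f = integral_circle g.
Proof.
by move=> fg; congr (_ +i* _); apply: eq_Rintegral => t; rewrite inE => /fg ->.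
Qed.

Lemma ae_eq_integral_circle f g : measurable_circle f -> measurable_circle g ->
  eq_ae f g -> integral_circle f = integral_circle g.
Proof.
move=> [fR fI] [gR gI] fg; congr (_ +i* _); congr fine; apply: ae_eq_integral => //;
  try exact/measurable_EFinP.
all: by move: fg; apply: ae_circleS => t _ ->.
Qed.

(** Dominated convergence for integrals with a common value: the approximations by radial
    dilation and by the kernel keep the integrals constant. *)
Lemma dominated_integral_circle (f_ : nat -> R -> R[i]) f u :
  (forall n, measurable_circle (f_ n)) -> measurable_circle f ->
  ae_circle (fun t => (f_ n t : R[i]^o) @[n --> \oo] --> (f t : R[i]^o)) ->
  mu.-integrable (@angles R) (EFin \o u) ->
  ae_circle (fun t => forall n, normc (f_ n t) <= u t) ->
  integrable_circle f /\
  (forall c, (forall n, integral_circle (f_ n) = c) -> integral_circle f = c).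
Proof.
move=> mf_ [mfR mfI] f_f ui f_u.
have [] := @dominated_convergence _ _ _ mu (@angles R) measurable_angles
  (fun n t => (complex.Re (f_ n t))%:E) (fun t => (complex.Re (f t))%:E) (EFin \o u).
- by move=> n; apply/measurable_EFinP; have [] := mf_ n.
- exact/measurable_EFinP.
- move: f_f; apply: ae_circleS => t _ /cvgc_ReIm[cR _].
  by apply: cvg_EFin => //; exact: nearW.
- exact: ui.
- move: f_u; apply: (@filterS _ _ (ae_filter_ringOfSetsType mu)).
  by move=> t fu n /fu le; rewrite lee_fin (le_trans (Re_le_normc _)).
move=> iR _ cR.
have [] := @dominated_convergence _ _ _ mu (@angles R) measurable_angles
  (fun n t => (complex.Im (f_ n t))%:E) (fun t => (complex.Im (f t))%:E) (EFin \o u).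
- by move=> n; apply/measurable_EFinP; have [] := mf_ n.
- exact/measurable_EFinP.
- move: f_f; apply: ae_circleS => t _ /cvgc_ReIm[_ cI].
  by apply: cvg_EFin => //; exact: nearW.
- exact: ui.
- move: f_u; apply: (@filterS _ _ (ae_filter_ringOfSetsType mu)).
  by move=> t fu n /fu le; rewrite lee_fin (le_trans (Im_le_normc _)).
move=> iI _ cI; split; first by split.
have lim_cst (I : nat -> \bar R) (L : \bar R) (k : R) : L \is a fin_num ->
    I n @[n --> \oo] --> L -> (forall n, fine (I n) = k) -> fine L = k.
  move=> Lfin; rewrite -{1}(fineK Lfin) => /fine_cvg IL Ik.
  have eI : fine \o I = cst k by apply/funext => n /=; rewrite Ik.
  move: IL; rewrite eI => /(@cvg_unique _ (@Rhausdorff R)); apply.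
  exact: cvg_cst.
move=> c fc; rewrite (complex_eta c) /integral_circle; congr (_ +i* _).
  apply: (lim_cst _ _ _ _ cR); first exact: integrable_fin_num.
  by move=> n; rewrite -(fc n).
apply: (lim_cst _ _ _ _ cI); first exact: integrable_fin_num.
by move=> n; rewrite -(fc n).
Qed.

(** Constant sequences turn a domination almost everywhere into integrability. *)
Lemma dominated_integrable_circle f u : measurable_circle f ->
  mu.-integrable (@angles R) (EFin \o u) ->
  ae_circle (fun t => normc (f t) <= u t) -> integrable_circle f.
Proof.
move=> mf ui fu; have [] // := @dominated_integral_circle (fun=> f) f u => //.
  by apply: ae_circle_all => t _; exact: cvg_cst.
by move: fu; apply: ae_circleS.
Qed.

Lemma bounded_integrable_circle f (M : R) : measurable_circle f ->
  ae_circle (fun t => normc (f t) <= M) -> integrable_circle f.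
Proof.
by move=> mf fM; apply: (dominated_integrable_circle mf _ fM); exact: cst_itv_integrable.
Qed.

Lemma integrable_circle_norm1 f : integrable_circle f ->
  mu.-integrable (@angles R) (EFin \o (fun t => `|complex.Re (f t)| + `|complex.Im (f t)|)).
Proof.
by move=> [fR fI]; apply: integrable_realD; exact: integrable_norm.
Qed.

Lemma integrable_circleMbounded f g (M : R) : integrable_circle f -> measurable_circle g ->
  ae_circle (fun t => normc (g t) <= M) -> integrable_circle (fun t => f t * g t).
Proof.
move=> fi mg gM.
apply: (dominated_integrable_circle (measurable_circleM (integrable_circle_measurable fi) mg)
  (integrable_realZ M (integrable_circle_norm1 fi))).
move: gM; apply: ae_circleS => t _ gM.
by rewrite normcM mulrC ler_pM// ?normc_ge0// normc_le_ReIm.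
Qed.

Lemma continuous_circle_measurable f : continuous (f : R -> R[i]^o) -> measurable_circle f.
Proof.
move=> cf; split; apply: (measurable_funS measurableT) => //;
  apply: continuous_measurable_fun => t; by have [] := cvgc_ReIm _ (cf t).
Qed.

Lemma normc_integral_circle_le f (M : R) : integrable_circle f ->
  (forall t, angles t -> normc (f t) <= M) -> normc (integral_circle f) <= 4 * pi * M.
Proof.
move=> [fR fI] fM; have p0 : 0 <= 2 * pi :> R by rewrite mulr_ge0// pi_ge0.
apply: (le_trans (normc_le_ReIm _)) => /=.
have := Rintegral_near_const (k := 0) (e := M) fR p0.
have := Rintegral_near_const (k := 0) (e := M) fI p0.
rewrite !mul0r !subr0 => hI hR.
have -> : 4 * pi * M = M * (2 * pi) + M * (2 * pi) by ring.
apply: lerD; [apply: hR|apply: hI] => t ht; rewrite subr0.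
  by apply: le_trans (Re_le_normc _) (fM _ _).
by apply: le_trans (Im_le_normc _) (fM _ _).
Qed.

(** Goursat's theorem on a rectangle of height [2 pi], whose horizontal sides cancel by
    periodicity. *)
Lemma periodic_mean_const (G : R[i] -> R[i]) (s s' : R) :
  (forall w, complex.Re w < 0 -> derivable (G : R[i]^o -> R[i]^o) w 1) ->
  (forall x, G (x +i* (2 * pi)) = G (x +i* 0)) -> s <= s' -> s' < 0 ->
  integral_circle (fun t => G (s +i* t)) = integral_circle (fun t => G (s' +i* t)).
Proof.
move=> dG pG ss s0.
have cl x t : x < 0 -> closed_at (fun s t => complex.Im (G (s +i* t)))
    (fun s t => complex.Re (G (s +i* t))) x t /\ closed_at (fun s t => - complex.Re (G (s +i* t))) (fun s t => complex.Im (G (s +i* t))) x t.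
  by move=> x0; apply: derivable_closed_at; exact: dG.
have p0 : 0 <= 2 * pi :> R by rewrite mulr_ge0// pi_ge0.
have intR x : x < 0 -> mu.-integrable (@angles R) (EFin \o (fun t => complex.Re (G (x +i* t)))).
  move=> x0; apply: continuous_itv_integrable => t _.
  by case: (closed_at_continuous (proj1 (cl x t x0))).
have intI x : x < 0 -> mu.-integrable (@angles R) (EFin \o (fun t => complex.Im (G (x +i* t)))).
  move=> x0; apply: continuous_itv_integrable => t _.
  by case: (closed_at_continuous (proj2 (cl x t x0))).
have s0' := le_lt_trans ss s0.
have := circulation_eq0 (fun x t x0 => (proj1 (cl x t x0))) ss p0 s0.
have := circulation_eq0 (fun x t x0 => (proj2 (cl x t x0))) ss p0 s0.
rewrite /circulation.
under [X in _ - X]eq_Rintegral do rewrite pG subrr.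
under [X in _ -> _ - X = _ -> _]eq_Rintegral do rewrite pG subrr.
rewrite !Rintegral_cst// !mul0r !subr0 !RintegralB ?intR ?intI// => /subr0_eq eI /subr0_eq eR.
by rewrite /integral_circle eI eR.
Qed.

End CircleIntegrals.
#[global] Hint Extern 0 (measurable (@angles _)) => exact: measurable_angles : core.

(** * Moments of holomorphic functions *)

Section HolomorphicMoments.
Variable R : realType.
Implicit Types (z w : R[i]) (F G : R[i] -> R[i]).

Lemma normc_real (x : R) : normc x%:C = `|x|.
Proof. by rewrite /= expr0n /= addr0 sqrtr_sqr. Qed.

Lemma derivable_compc F G z : derivable (G : R[i]^o -> R[i]^o) z 1 ->
  derivable (F : R[i]^o -> R[i]^o) (G z) 1 ->
  derivable ((fun w => F (G w)) : R[i]^o -> R[i]^o) z 1.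
Proof.
move=> /derivable1_diffP dG /derivable1_diffP dF; apply/derivable1_diffP.
exact: (@differentiable_comp R[i] R[i]^o R[i]^o R[i]^o G F z dG dF).
Qed.

Lemma derivable_mulc F G z : derivable (F : R[i]^o -> R[i]^o) z 1 ->
  derivable (G : R[i]^o -> R[i]^o) z 1 ->
  derivable ((fun w => F w * G w) : R[i]^o -> R[i]^o) z 1.
Proof. exact: derivableM. Qed.

Lemma derivable_powc F n z : derivable (F : R[i]^o -> R[i]^o) z 1 ->
  derivable ((fun w => F w ^+ n) : R[i]^o -> R[i]^o) z 1.
Proof.
move=> dF; elim: n => [|n IH]; first exact: derivable_cst.
by under eq_fun do rewrite exprS; exact: derivable_mulc.
Qed.

Lemma derivable_continuous_at F z : derivable (F : R[i]^o -> R[i]^o) z 1 ->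
  {for z, continuous (F : R[i]^o -> R[i]^o)}.
Proof. by move=> /derivable1_diffP; exact: differentiable_continuous. Qed.

Lemma continuous_polar (r : R) : continuous (polar r : R -> R[i]^o).
Proof.
move=> t; apply: ReIm_cvgc => /=; apply: cvgM; try exact: cvg_cst.
  exact: continuous_cos.
exact: continuous_sin.
Qed.

Lemma disc_polar (r t : R) : 0 <= r < 1 -> disc (polar r t).
Proof. by move=> /andP[r0 r1]; rewrite /disc /mkset normc_polar. Qed.

Lemma holomorphic_circle_continuous F (r : R) : holomorphic F -> 0 <= r < 1 ->
  continuous ((fun t => F (polar r t)) : R -> R[i]^o).
Proof.
move=> hF r01 t.
apply: (@continuous_comp _ _ _ (polar r : R -> R[i]^o) (F : R[i]^o -> R[i]^o)).
  exact: continuous_polar.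
by apply: derivable_continuous_at; apply: hF; exact: disc_polar.
Qed.

Lemma continuous_mulc (f g : R -> R[i]) : continuous (f : R -> R[i]^o) ->
  continuous (g : R -> R[i]^o) -> continuous ((fun t => f t * g t) : R -> R[i]^o).
Proof. by move=> cf cg t; apply: cvgM; [exact: cf|exact: cg]. Qed.

Lemma continuous_powc (f : R -> R[i]) n : continuous (f : R -> R[i]^o) ->
  continuous ((fun t => f t ^+ n) : R -> R[i]^o).
Proof.
move=> cf; elim: n => [|n IH]; first by move=> t; exact: cvg_cst.
by under eq_fun do rewrite exprS; exact: continuous_mulc.
Qed.

Lemma continuous_conjc (f : R -> R[i]) : continuous (f : R -> R[i]^o) ->
  continuous ((fun t => conjc (f t)) : R -> R[i]^o).
Proof. by move=> cf t; apply: cvgc_conj; exact: cf. Qed.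

Lemma continuous_integrable_circle (f : R -> R[i]) : continuous (f : R -> R[i]^o) ->
  integrable_circle f.
Proof.
move=> cf; split; apply: continuous_itv_integrable => t _;
  by have [] := cvgc_ReIm _ (cf t).
Qed.

Lemma moment_continuous F (r : R) j n : holomorphic F -> 0 <= r < 1 ->
  continuous ((fun t => (F (polar r t) - F 0) ^+ n *
     (polar 1 t ^+ j * conjc (polar 1 t) ^+ n)) : R -> R[i]^o).
Proof.
move=> hF r01; apply: continuous_mulc.
  apply: continuous_powc => t; apply: cvgB; last exact: cvg_cst.
  exact: holomorphic_circle_continuous.
apply: continuous_mulc; apply: continuous_powc; first exact: continuous_polar.
by apply: continuous_conjc; exact: continuous_polar.
Qed.

Lemma expr_le_self (x : R) j : (0 < j)%N -> 0 <= x -> x <= 1 -> x ^+ j <= x.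
Proof.
by case: j => // j _ x0 x1; rewrite exprS ler_piMr// exprn_ile1.
Qed.

Lemma holomorphic_lipschitz0 F : holomorphic F -> exists C rho : R,
  [/\ 0 <= C, 0 < rho & forall z, normc z < rho -> normc (F z - F 0) <= C * normc z].
Proof.
move=> hF; have [|d /(_ 1 ltr01)[rho rho0 hd]] := @derivable_first_order _ F 0.
  by apply: hF; rewrite /disc /mkset normc0.
move: rho0; rewrite ltcE /= => /andP[/eqP rhoI rho0].
exists (normc d + 1), (complex.Re rho); split => //.
  by rewrite addr_ge0 ?normc_ge0.
move=> z zrho; have := hd z.
rewrite normc_real_norm (complex_eta rho) rhoI complexr0 ltcR => /(_ zrho).
rewrite addr0 mul1r normc_real_norm lecR => {hd} h1.
rewrite -[F z - F 0](subrK (d * z)).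
apply: (le_trans (le_normcD _ _)); rewrite normcM mulrDl mul1r [leRHS]addrC.
exact: lerD h1 (lexx _).
Qed.

(** Dividing [F - F 0] by [z] leaves a function without negative Fourier modes.  In
    the coordinate [w = log z] the apparent pole at the origin is moved to
    infinity, where periodicity and the decay of [z ^+ j] replace the removal of
    the singularity. *)
Lemma vanishing_moments F (r : R) j n : holomorphic F -> 0 < r < 1 -> (0 < j)%N ->
  integral_circle (fun t => (F (polar r t) - F 0) ^+ n *
     (polar 1 t ^+ j * conjc (polar 1 t) ^+ n)) = 0.
Proof.
move=> hF /andP[r0 r1] j0.
pose G w := ((F (expc w) - F 0) * expc (- w)) ^+ n * expc w ^+ j.
have dG w : complex.Re w < 0 -> derivable (G : R[i]^o -> R[i]^o) w 1.
  move=> w0; apply: derivable_mulc; apply: derivable_powc; last exact: derivable_expc.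
  apply: derivable_mulc.
    apply: derivableB; last exact: derivable_cst.
    apply: derivable_compc; first exact: derivable_expc.
    by apply: hF; rewrite /disc /mkset normc_expc expR_lt1.
  apply: derivable_compc; last exact: derivable_expc.
  by apply: derivableN; exact: derivable_id.
have pG x : G (x +i* (2 * pi)) = G (x +i* 0).
  by rewrite /G /expc !(ReN, ImN) /= -[2 * pi]add0r polar_periodic
    -(polar_periodic _ (- _)) add0r addNr oppr0.
have Gpolar x t : 0 < x -> G (ln x +i* t) =
    (x^-1 ^+ n * x ^+ j)%:C * ((F (polar x t) - F 0) ^+ n *
     (polar 1 t ^+ j * conjc (polar 1 t) ^+ n)).
  move=> x0; rewrite /G /expc !(ReN, ImN) /= expRN lnK ?posrE//.
  rewrite [polar x^-1 _]polar_scale -conjc_polar [in X in _ * X = _]polar_scale !exprMn.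
  by rewrite rmorphM !rmorphXn /=; ring.
have mean_r : integral_circle (fun t => G (ln r +i* t)) =
    (r^-1 ^+ n * r ^+ j)%:C * integral_circle (fun t => (F (polar r t) - F 0) ^+ n *
     (polar 1 t ^+ j * conjc (polar 1 t) ^+ n)).
  rewrite -integral_circleZ; last first.
    by apply: continuous_integrable_circle; apply: moment_continuous; rewrite // ltW.
  by apply: eq_integral_circle => t _; exact: Gpolar.
suff small e : 0 < e -> normc (integral_circle (fun t => G (ln r +i* t))) <= e.
  have : normc (integral_circle (fun t => G (ln r +i* t))) = 0.
    apply/eqP; rewrite eq_le normc_ge0 andbT.
    by apply/ler_addgt0Pr => e e0; rewrite add0r; exact: small.
  move=> /eq0_normc; rewrite mean_r => /eqP; rewrite mulf_eq0 => /orP[|/eqP//].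
  by move=> /eqP[] /eqP; rewrite mulf_eq0 !expf_eq0 invr_eq0 (gt_eqF r0) !andbF.
move=> e0; have [L [rho [L0 rho0 hL]]] := holomorphic_lipschitz0 hF.
pose C := L ^+ n; have C0 : 0 <= C by exact: exprn_ge0.
have pC0 : 0 < 4 * pi * C + 1.
  by rewrite ltr_pwDr// !mulr_ge0// pi_ge0.
(* The mean is moved to a radius [x] so small that the Lipschitz bound at the origin
   makes the integrand at most [C * x]. *)
have [x [x0 xr xrho xe x1]] : exists x : R,
    [/\ 0 < x, x <= r, x < rho, x <= e / (4 * pi * C + 1) & x < 1].
  pose y := Num.min r (Num.min (rho / 2) (e / (4 * pi * C + 1))).
  have y0 : 0 < y by rewrite !lt_min r0 !divr_gt0.
  have yr : y <= r by rewrite ge_min lexx.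
  have yrho : y <= rho / 2 by rewrite !ge_min lexx orbT.
  have ye : y <= e / (4 * pi * C + 1) by rewrite !ge_min lexx !orbT.
  by exists y; split => //; lra.
have lnx : ln x <= ln r by rewrite ler_ln.
have lnr : ln r < 0 by rewrite ln_lt0// r0.
have meanE := periodic_mean_const dG pG lnx lnr.
apply: (@le_trans _ _ (normc (integral_circle (fun t => G (ln x +i* t))))).
  by rewrite meanE.
have bound t : normc (G (ln x +i* t)) <= C * x.
  have xE : normc (polar x t) = x := normc_polar t (ltW x0).
  have hFx : normc (F (polar x t) - F 0) <= L * x by rewrite -{2}xE; apply: hL; rewrite xE.
  have E1 : normc (polar 1 t) = 1 by rewrite normc_polar.
  rewrite (Gpolar _ _ x0) !normcM !normcX normcJ E1 !expr1n !mulr1.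
  rewrite normc_real ger0_norm; last first.
    by rewrite mulr_ge0 ?exprn_ge0 ?invr_ge0 ?(ltW x0).
  have xj := expr_le_self j0 (ltW x0) (ltW x1).
  have -> : x^-1 ^+ n * x ^+ j * normc (F (polar x t) - F 0) ^+ n =
      (normc (F (polar x t) - F 0) / x) ^+ n * x ^+ j by rewrite exprMn; ring.
  have q0 : 0 <= normc (F (polar x t) - F 0) / x.
    exact: divr_ge0 (normc_ge0 _) (ltW x0).
  apply: ler_pM xj; [exact: exprn_ge0|exact: exprn_ge0 (ltW x0)|].
  apply: lerXn2r; rewrite ?nnegrE; [exact: q0|exact: L0|].
  rewrite ler_pdivrMr; [exact: hFx|exact: x0].
have GI : integrable_circle (fun t => G (ln x +i* t)).
  have -> : (fun t => G (ln x +i* t)) = (fun t => (x^-1 ^+ n * x ^+ j)%:C *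
      ((F (polar x t) - F 0) ^+ n * (polar 1 t ^+ j * conjc (polar 1 t) ^+ n))).
    by apply/funext => t; exact: Gpolar.
  apply: integrable_circleZ; apply: continuous_integrable_circle.
  by apply: moment_continuous; [exact: hF|rewrite (ltW x0) x1].
apply: (le_trans (normc_integral_circle_le GI (fun t _ => bound t))).
rewrite mulrA; apply: (@le_trans _ _ ((4 * pi * C + 1) * x)).
  by rewrite ler_wpM2r ?(ltW x0) ?lerDl.
by rewrite mulrC -ler_pdivlMr.
Qed.

End HolomorphicMoments.

(** * Radial limits *)

Section BoundaryValues.
Variable R : realType.
Local Notation mu := (@lebesgue_measure R).
Implicit Types (f g h theta : R -> R[i]) (F : R[i] -> R[i]).

Lemma cvg_at_left1 (u : nat -> R) : (forall n, u n < 1) ->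
  (u n @[n --> \oo] --> (1 : R)) -> u n @[n --> \oo] --> (1 : R)^'-.
Proof.
move=> u1 ul A; rewrite /at_left => -[e /= e0 eA].
move/cvgrPdist_lt : ul => /(_ e e0); apply: filterS => n ne.
by apply: eA => //=; rewrite /ball /= ne.
Qed.

Definition radius (n : nat) : R := 1 - n.+2%:R^-1.

Lemma radius01 n : 0 < radius n < 1.
Proof.
rewrite /radius subr_gt0 gtrBl invr_gt0 ltr0n andbT.
by rewrite invf_lt1 ?ltr0n// ltr1n.
Qed.

Lemma radius_cvg : radius n @[n --> \oo] --> (1 : R)^'-.
Proof.
apply: cvg_at_left1 => [n|]; first by have /andP[] := radius01 n.
rewrite -[X in _ --> X]subr0; apply: cvgB; first exact: cvg_cst.
have := @cvg_harmonic R; rewrite -(cvg_shiftn 1); apply: cvg_trans.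
by apply: near_eq_cvg; apply: nearW => n; rewrite /harmonic /= addn1.
Qed.

Lemma boundary_sequence F f : boundary_value F f -> ae_circle (fun t =>
  (F (polar (radius n) t) : R[i]^o) @[n --> \oo] --> (f t : R[i]^o)).
Proof. by apply: ae_circleS => t _ Ff; exact: cvg_comp radius_cvg Ff. Qed.

(** Moments pass to the boundary along the radii [radius n]: the test functions stay
    bounded since [F] is. *)
Lemma boundary_moments F f g (M : R) (alpha c : R[i]) (n p q : nat) :
  holomorphic F -> (forall z, disc z -> normc (F z) <= M) ->
  boundary_value F f -> measurable_circle f -> integrable_circle g ->
  (forall r : R, 0 < r < 1 -> integral_circle (fun t => g t *
     conjc ((F (polar r t) - alpha) ^+ n * (polar 1 t ^+ p * conjc (polar 1 t) ^+ q))) = c) ->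
  integral_circle (fun t => g t *
     conjc ((f t - alpha) ^+ n * (polar 1 t ^+ p * conjc (polar 1 t) ^+ q))) = c.
Proof.
move=> hF FM Ff mf gi gF.
have mE : measurable_circle (fun t : R => polar 1 t ^+ p * conjc (polar 1 t) ^+ q).
  apply: measurable_circleM; apply: measurable_circleX; try apply: measurable_circleJ;
    by apply: continuous_circle_measurable; exact: continuous_polar.
have mphi (h : R -> R[i]) : measurable_circle h -> measurable_circle (fun t => g t *
    conjc ((h t - alpha) ^+ n * (polar 1 t ^+ p * conjc (polar 1 t) ^+ q))).
  move=> mh; apply: measurable_circleM; first exact: integrable_circle_measurable.
  apply: measurable_circleJ; apply: measurable_circleM => //; apply: measurable_circleX.
  by apply: measurable_circleD => //; exact: measurable_circle_cst.
have [] := @dominated_integral_circle R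
  (fun k t => g t * conjc ((F (polar (radius k) t) - alpha) ^+ n *
     (polar 1 t ^+ p * conjc (polar 1 t) ^+ q)))
  (fun t => g t * conjc ((f t - alpha) ^+ n * (polar 1 t ^+ p * conjc (polar 1 t) ^+ q)))
  (fun t => (M + normc alpha) ^+ n * (`|complex.Re (g t)| + `|complex.Im (g t)|)).
- move=> k; apply: mphi; apply: continuous_circle_measurable.
  apply: holomorphic_circle_continuous => //.
  by have /andP[r0 r1] := radius01 k; rewrite ltW.
- exact: mphi.
- move: (boundary_sequence Ff); apply: ae_circleS => t _ Ft.
  apply: cvgM; first exact: cvg_cst.
  apply: cvgc_conj; apply: cvgM; last exact: cvg_cst.
  have powc (k : nat) : ((F (polar (radius m) t) - alpha) ^+ k : R[i]^o) @[m --> \oo] -->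
      ((f t - alpha) ^+ k : R[i]^o).
    elim: k => [|k IH]; first exact: cvg_cst.
    under eq_fun do rewrite exprS; rewrite exprS; apply: cvgM; last exact: IH.
    by apply: cvgB; [exact: Ft|exact: cvg_cst].
  exact: powc.
- by apply: integrable_realZ; exact: integrable_circle_norm1.
- apply: ae_circle_all => t _ k.
  have E1 : normc (polar 1 t) = 1 by rewrite normc_polar.
  rewrite normcM normcJ !normcM !normcX normcJ E1 !expr1n !mulr1 mulrC.
  rewrite ler_pM// ?normc_ge0 ?exprn_ge0 ?normc_ge0 ?normc_le_ReIm//.
  have FM' : normc (F (polar (radius k) t)) <= M.
    by apply: FM; apply: disc_polar; have /andP[r0 r1] := radius01 k; rewrite ltW.
  have M0 : 0 <= M by exact: le_trans (normc_ge0 _) FM'.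
  rewrite lerXn2r ?nnegrE ?addr_ge0 ?normc_ge0//.
  by rewrite (le_trans (le_normcD _ _))// normcN lerD.
by move=> _; apply => k; apply: gF; exact: radius01.
Qed.

Lemma boundary_mean F f : Hinfty_disc F -> boundary_value F f -> measurable_circle f ->
  integrable_circle f -> integral_circle f = (2 * pi)%:C * F 0.
Proof.
move=> [hF [M FM]] Ff mf fi.
have := @boundary_moments F f (fun=> 1) M (F 0) 0 1 1 1 hF FM Ff mf (integrable_circle_cst 1).
have E1 (t : R) z : z ^+ 1 * (polar 1 t ^+ 1 * conjc (polar 1 t) ^+ 1) = z.
  by rewrite !expr1 polar1_conj mulr1.
under eq_integral_circle do rewrite mul1r E1.
have conj0 (h : R -> R[i]) : integrable_circle h -> integral_circle h = 0 ->
    integral_circle (fun t => conjc (h t)) = 0.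
  by move=> hi h0; rewrite integral_circleJ// h0 conjc0.
have fci c : integrable_circle (fun t => f t - c).
  exact: integrable_circleD fi (integrable_circle_cst _).
rewrite integral_circleJ//.
move=> H; have /eqP : conjc (integral_circle (fun t => f t - F 0)) = 0.
  apply: H => r r01; under eq_integral_circle do rewrite mul1r E1.
  have := @vanishing_moments R F r 1 1 hF r01 isT.
  under eq_integral_circle do rewrite E1.
  apply: conj0.
  apply: continuous_integrable_circle => t; apply: cvgB; last exact: cvg_cst.
  by apply: holomorphic_circle_continuous => //; have /andP[/ltW -> ->] := r01.
rewrite conjc_eq0 integral_circleB ?integral_circle_cst; last 2 first.
- by [].
- exact: integrable_circle_cst.
by rewrite subr_eq0 => /eqP.
Qed.

End BoundaryValues.

(** * Hardy spaces and projections *)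

Section HardySpaces.
Variable R : realType.
Local Notation mu := (@lebesgue_measure R).
Implicit Types (f g h m p theta phi : R -> R[i]) (F : R[i] -> R[i]).

Lemma conjcM (z w : R[i]) : conjc (z * w) = conjc z * conjc w.
Proof. exact: rmorphM. Qed.

Lemma conjcX (z : R[i]) k : conjc (z ^+ k) = conjc z ^+ k.
Proof. exact: rmorphXn. Qed.

Lemma conjcB (z w : R[i]) : conjc (z - w) = conjc z - conjc w.
Proof. exact: rmorphB. Qed.

Lemma measurable_normc_sqr f : measurable_circle f ->
  measurable_fun (@angles R) (fun t => (normc (f t) ^+ 2)%:E).
Proof.
move=> [fR fI]; apply/measurable_EFinP.
under eq_fun do rewrite normc_sqr.
by apply: measurable_funD; apply: measurable_funX.
Qed.

Lemma L2_integrable f : L2 f ->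
  mu.-integrable (@angles R) (EFin \o (fun t => normc (f t) ^+ 2)).
Proof.
move=> [mf fy]; apply/integrableP; split; first exact: measurable_normc_sqr.
under eq_integral => t _ do rewrite gee0_abs ?lee_fin ?sqr_ge0//.
exact: fy.
Qed.

Lemma L2_dominated f (u : R -> R) : measurable_circle f ->
  mu.-integrable (@angles R) (EFin \o u) ->
  (forall t, angles t -> normc (f t) ^+ 2 <= u t) -> L2 f.
Proof.
move=> mf /integrableP[mu_ uy] fu; split => //.
apply: le_lt_trans uy; apply: ge0_le_integral.
- exact: measurable_angles.
- by move=> t _; rewrite lee_fin sqr_ge0.
- exact: measurable_normc_sqr.
- exact: measurableT_comp.
- by move=> t at_; rewrite /comp abse_EFin lee_fin; apply: le_trans (fu _ at_) (ler_norm _).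
Qed.

Lemma sqr_le_sum (a b c : R) : 0 <= c -> c <= a + b ->
  c ^+ 2 <= 2 * a ^+ 2 + 2 * b ^+ 2.
Proof.
move=> c0 cab; apply: (@le_trans _ _ ((a + b) ^+ 2)).
  by rewrite lerXn2r ?nnegrE// (le_trans c0).
by have := sqr_ge0 (a - b); rewrite !expr2; lra.
Qed.

Lemma L2D f g : L2 f -> L2 g -> L2 (fun t => f t + g t).
Proof.
move=> Lf Lg; apply: (@L2_dominated _ (fun t => 2 * normc (f t) ^+ 2 + 2 * normc (g t) ^+ 2)).
- by apply: measurable_circleD; [case: Lf|case: Lg].
- by apply: integrable_realD; apply: integrable_realZ; exact: L2_integrable.
- move=> t _; apply: sqr_le_sum; [exact: normc_ge0|exact: le_normcD].
Qed.

Lemma L2N f : L2 f -> L2 (fun t => - f t).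
Proof.
move=> Lf; apply: (L2_dominated _ (L2_integrable Lf)).
  by apply: measurable_circleN; case: Lf.
by move=> t _; rewrite normcN.
Qed.

Lemma L2B f g : L2 f -> L2 g -> L2 (fun t => f t - g t).
Proof. by move=> Lf Lg; exact: L2D Lf (L2N Lg). Qed.

Lemma ae_eq_normc_L2 f g : measurable_circle f -> L2 g ->
  ae_circle (fun t => normc (f t) = normc (g t)) -> L2 f.
Proof.
move=> mf [mg gy] fg; split => //.
apply: le_lt_trans gy; rewrite le_eqVlt; apply/orP; left; apply/eqP.
apply: ae_eq_integral.
- exact: measurable_angles.
- exact: measurable_normc_sqr.
- exact: measurable_normc_sqr.
- by move: fg; apply: ae_circleS => t _ ->.
Qed.

Lemma L2_inner_integrable f g : L2 f -> L2 g ->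
  integrable_circle (fun t => f t * conjc (g t)).
Proof.
move=> Lf Lg; have [mf _] := Lf; have [mg _] := Lg.
apply: (@dominated_integrable_circle _ _ (fun t => normc (f t) ^+ 2 + normc (g t) ^+ 2)).
- exact: measurable_circleM mf (measurable_circleJ mg).
- by apply: integrable_realD; exact: L2_integrable.
- apply: ae_circle_all => t _; rewrite normcM normcJ.
  move: (normc (f t)) (normc (g t)) (normc_ge0 (f t)) (normc_ge0 (g t)) => a b a0 b0.
  by have := sqr_ge0 (a - b); have := mulr_ge0 a0 b0; rewrite !expr2; lra.
Qed.

Lemma L2_integrable_circle f : L2 f -> integrable_circle f.
Proof.
move=> Lf; have [mf _] := Lf.
apply: (@dominated_integrable_circle _ _ (fun t => 1 + normc (f t) ^+ 2)) => //.
  by apply: integrable_realD (L2_integrable Lf); exact: cst_itv_integrable.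
apply: ae_circle_all => t _; move: (normc (f t)) (normc_ge0 (f t)) => a a0.
by have := sqr_ge0 (a - 1); rewrite !expr2; lra.
Qed.

Lemma inner_productB f g h : L2 f -> L2 g -> L2 h ->
  inner_product (fun t => f t - g t) h = inner_product f h - inner_product g h.
Proof.
move=> Lf Lg Lh; rewrite /inner_product -integral_circleB; try exact: L2_inner_integrable.
by apply: eq_integral_circle => t _; rewrite mulrBl.
Qed.

Lemma inner_productJ f g : L2 f -> L2 g -> inner_product g f = conjc (inner_product f g).
Proof.
move=> Lf Lg; rewrite /inner_product -integral_circleJ; last exact: L2_inner_integrable.
by apply: eq_integral_circle => t _; rewrite conjcM conjcK mulrC.
Qed.

Lemma integral_normc_sqr_eq0 f : measurable_circle f ->
  mu.-integrable (@angles R) (EFin \o (fun t => normc (f t) ^+ 2)) ->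
  \int[mu]_(t in @angles R) (normc (f t) ^+ 2) = 0 -> eq_ae f (fun=> 0).
Proof.
move=> mf fi f0.
have : (\int[mu]_(t in @angles R) `|(normc (f t) ^+ 2)%:E| = 0)%E.
  under eq_integral => t _ do rewrite gee0_abs ?lee_fin ?sqr_ge0//.
  rewrite -[LHS]fineK; first by rewrite -/(Rintegral _ _ _) f0.
  by apply: (@integrable_fin_num _ _ _ mu); [exact: measurable_angles|exact: fi].
move=> abs0; have := (@ae_eq_integral_abs _ _ _ mu (@angles R) (@measurable_angles R) _
  (measurable_normc_sqr mf)).1 abs0.
apply: ae_circleS => t _ /= [] /eqP; rewrite sqrf_eq0 => /eqP; exact: eq0_normc.
Qed.

Lemma inner_product_self_eq0 f : L2 f -> inner_product f f = 0 -> eq_ae f (fun=> 0).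
Proof.
move=> Lf; have [mf _] := Lf.
rewrite /inner_product /integral_circle => -[f0 _].
apply: integral_normc_sqr_eq0 => //; first exact: L2_integrable.
rewrite -[RHS]f0; apply: eq_Rintegral => t _.
by rewrite mulcJ_normc.
Qed.

(** The difference of two candidates [p] and [q] is orthogonal to [p] and to [q], hence to
    itself. *)
Lemma orthogonal_projection_unique (V : set (R -> R[i])) phi p :
  V `<=` @L2 R -> L2 phi -> V p ->
  (forall h, V h -> inner_product (fun t => phi t - p t) h = 0) ->
  eq_ae p (orthogonal_projection V phi).
Proof.
move=> VL Lphi Vp porth; rewrite /orthogonal_projection.
case: xgetP => [q _ [Vq qorth]|/(_ p) no]; last by exfalso; apply: no.
have Lp := VL _ Vp; have Lq := VL _ Vq.
have diff0 h : V h -> inner_product (fun t => p t - q t) h = 0.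
  move=> Vh; have Lh := VL _ Vh.
  rewrite (_ : (fun t => p t - q t) = (fun t => (phi t - q t) - (phi t - p t))).
    by rewrite inner_productB ?porth ?qorth ?subrr//; exact: L2B.
  by apply/funext => t; ring.
have : inner_product (fun t => p t - q t) (fun t => p t - q t) = 0.
  rewrite inner_productJ; try exact: L2B.
  rewrite inner_productB//; last exact: L2B.
  rewrite (inner_productJ _ Lp) ?(inner_productJ _ Lq); try exact: L2B.
  by rewrite !diff0// conjc0 subrr conjc0.
move=> /(inner_product_self_eq0 (L2B Lp Lq)); apply: ae_circleS => t _.
exact: subr0_eq.
Qed.

Lemma H2p_L2 : @H2p R `<=` @L2 R. Proof. by move=> f []. Qed.
Lemma H2m_L2 : @H2m R `<=` @L2 R. Proof. by move=> f []. Qed.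

Lemma Pp_eq p m : H2p p -> H2m m -> eq_ae p (Pp (fun t => p t + m t)).
Proof.
move=> hp [Lm om]; apply: orthogonal_projection_unique => //; first exact: H2p_L2.
  exact: L2D (H2p_L2 hp) Lm.
move=> h hh; rewrite (_ : (fun t => _) = m); first exact: om.
by apply/funext => t; ring.
Qed.

Lemma Pm_eq p m : H2p p -> H2m m -> eq_ae m (Pm (fun t => p t + m t)).
Proof.
move=> hp hm; have [Lm om] := hm; have Lp := H2p_L2 hp.
apply: orthogonal_projection_unique => //; first exact: H2m_L2.
  exact: L2D.
move=> h [Lh oh]; rewrite (_ : (fun t => _) = p).
  by rewrite inner_productJ// oh// conjc0.
by apply/funext => t; ring.
Qed.

Lemma L2_cst (c : R[i]) : L2 (fun=> c).
Proof.
apply: (@L2_dominated _ (cst (normc c ^+ 2))).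
- exact: measurable_circle_cst.
- exact: cst_itv_integrable.
- by move=> t _; exact: lexx.
Qed.

Lemma angles_measure : mu (@angles R) = (2 * pi)%:E.
Proof.
by rewrite /angles lebesgue_measure_itv/= lte_fin mulr_gt0 ?pi_gt0// sube0.
Qed.

Lemma H2p_cst (c : R[i]) : H2p (fun=> c).
Proof.
split; first exact: L2_cst.
exists (fun=> c); last by apply: ae_circle_all => t _; exact: cvg_cst.
split; first by move=> z _; exact: derivable_cst.
exists (normc c ^+ 2 * (2 * pi)) => r _.
have e1 := @integral_cst _ _ _ mu (@angles R) (@measurable_angles R) (normc c ^+ 2)%:E.
have e2 := congr1 (fun x => (normc c ^+ 2)%:E * x)%E angles_measure.
by have := etrans e1 e2 => /= ->; exact: lexx.
Qed.

Lemma H2m0 : H2m (fun=> 0 : R[i]).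
Proof.
split; first exact: L2_cst.
move=> h _; rewrite /inner_product -[RHS](integral_circle0 R).
by apply: eq_integral_circle => t _; rewrite mul0r.
Qed.

(** When a projection does not exist, its default value [0] still lies in the subspace;
    so the decomposition is available before knowing whether [H2p] is closed. *)
Lemma kerp_pairedP a b g : kerp_paired a b g <->
  L2 g /\ exists p m, [/\ H2p p, H2m m, eq_ae g p &
    ae_circle (fun t => a t * p t + b t * m t = 0)].
Proof.
split=> [[Lg [phi [Lphi ker] gp]]|[Lg [p [m [hp hm gp ker]]]]].
  split => //; exists (Pp phi), (Pm phi); split => //.
    by rewrite /Pp /orthogonal_projection; case: xgetP => [q _ []//|_]; exact: H2p_cst.
  by rewrite /Pm /orthogonal_projection; case: xgetP => [q _ []//|_]; exact: H2m0.
have pP := Pp_eq hp hm; have mP := Pm_eq hp hm.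
split => //; exists (fun t => p t + m t); last first.
  by apply: (ae_circleS2 _ gp pP) => t _ -> ->.
split; first exact: L2D (H2p_L2 hp) (H2m_L2 hm).
have pmP : ae_circle (fun t => p t = Pp (fun t => p t + m t) t /\
    m t = Pm (fun t => p t + m t) t) by apply: (ae_circleS2 _ pP mP).
by apply: (ae_circleS2 _ ker pmP) => t _ <- [e1 e2]; rewrite /paired_operator -e1 -e2.
Qed.

Lemma inner_functionM theta1 theta2 : inner_function theta1 -> inner_function theta2 ->
  inner_function (fun t => theta1 t * theta2 t).
Proof.
move=> [m1 [F1 [h1 [M1 b1]] bd1] n1] [m2 [F2 [h2 [M2 b2]] bd2] n2]; split.
- exact: measurable_circleM.
- exists (fun z => F1 z * F2 z).
    split; first by move=> z dz; apply: derivable_mulc; [exact: h1|exact: h2].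
    exists (M1 * M2) => z dz; rewrite normcM.
    by apply: ler_pM; [exact: normc_ge0|exact: normc_ge0|exact: b1|exact: b2].
  by apply: (ae_circleS2 _ bd1 bd2) => t _ c1 c2; apply: cvgM; [exact: c1|exact: c2].
- by apply: (ae_circleS2 _ n1 n2) => t _ e1 e2; rewrite normcM e1 e2 mulr1.
Qed.

Lemma polar1_inner : inner_function (polar 1 : R -> R[i]).
Proof.
split.
- exact: continuous_circle_measurable (@continuous_polar R 1).
- exists id.
    split; first by move=> z _; exact: derivable_id.
    by exists 1 => z /ltW.
  apply: ae_circle_all => t _; apply: ReIm_cvgc => /=.
    by rewrite mul1r -{2}[cos t]mul1r; apply: cvgMl; exact: cvg_at_left_filter (@cvg_id _ _).
  by rewrite mul1r -{2}[sin t]mul1r; apply: cvgMl; exact: cvg_at_left_filter (@cvg_id _ _).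
- by apply: ae_circle_all => t _; exact: normc_polar.
Qed.

Lemma H2p_mul_inner theta h : inner_function theta -> H2p h ->
  H2p (fun t => theta t * h t).
Proof.
move=> [mt [F1 [h1 [M1 b1]] bd1] n1] [Lh [F2 [h2 [M2 b2]] bd2]]; have [mh _] := Lh; split.
  apply: (ae_eq_normc_L2 (measurable_circleM mt mh) Lh).
  by move: n1; apply: ae_circleS => t _ e1; rewrite normcM e1 mul1r.
exists (fun z => F1 z * F2 z); last first.
  by apply: (ae_circleS2 _ bd1 bd2) => t _ c1 c2; apply: cvgM; [exact: c1|exact: c2].
split; first by move=> z dz; apply: derivable_mulc; [exact: h1|exact: h2].
exists (M1 ^+ 2 * M2) => r r01.
have mF2 : measurable_fun (@angles R) (fun t => (normc (F2 (polar r t)) ^+ 2)%:E).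
  apply: measurable_normc_sqr; apply: continuous_circle_measurable.
  exact: holomorphic_circle_continuous.
apply: (@le_trans _ _ (\int[mu]_(t in @angles R) ((M1 ^+ 2)%:E * (normc (F2 (polar r t)) ^+ 2)%:E))%E).
  apply: ge0_le_integral.
  - exact: measurable_angles.
  - by move=> t _; rewrite lee_fin sqr_ge0.
  - apply: measurable_normc_sqr; apply: continuous_circle_measurable.
    by apply: continuous_mulc; exact: holomorphic_circle_continuous.
  - exact: measurable_funeM.
  - move=> t _; rewrite -EFinM lee_fin normcM exprMn ler_wpM2r ?sqr_ge0//.
    have le1 := b1 _ (disc_polar t r01).
    by rewrite lerXn2r ?nnegrE ?normc_ge0// (le_trans (normc_ge0 _) le1).
rewrite ge0_integralZl.
- rewrite (EFinM (M1 ^+ 2)); apply: lee_wpmul2l; first by rewrite lee_fin sqr_ge0.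
  exact: b2.
- exact: measurable_angles.
- exact: mF2.
- by move=> t _; rewrite lee_fin sqr_ge0.
- by rewrite lee_fin sqr_ge0.
Qed.

Lemma H2p_monomial k : H2p (fun t : R => polar 1 t ^+ k).
Proof.
elim: k => [|k IH]; first exact: H2p_cst.
by under eq_fun do rewrite exprS; exact: H2p_mul_inner polar1_inner IH.
Qed.

Lemma H2m_mul_inner_conj theta m : inner_function theta -> H2m m ->
  H2m (fun t => conjc (theta t) * m t).
Proof.
move=> it [Lm om]; have [mt _ n1] := it; have [mm _] := Lm; split.
  apply: (ae_eq_normc_L2 (measurable_circleM (measurable_circleJ mt) mm) Lm).
  by move: n1; apply: ae_circleS => t _ e1; rewrite normcM normcJ e1 mul1r.
move=> h hh; rewrite -(om _ (H2p_mul_inner it hh)).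
by apply: eq_integral_circle => t _; rewrite conjcM; ring.
Qed.

End HardySpaces.

(** * Characters and a trigonometric kernel *)

Section TrigonometricKernel.
Variable R : realType.
Local Notation mu := (@lebesgue_measure R).
Implicit Types (f g : R -> R[i]) (s t : R).

(** The function [e^{i(p-q)t}]; the pair [(p, q)] replaces a signed frequency. *)
Definition character (p q : nat) t : R[i] := polar 1 t ^+ p * conjc (polar 1 t) ^+ q.

Lemma character_shift p q k t : character (p + k) (q + k) t = character p q t.
Proof.
rewrite /character !exprD mulrACA -[in X in _ * X = _]exprMn polar1_conj expr1n.
by rewrite mulr1.
Qed.

Lemma character_eq p q p' q' t : (p + q' = p' + q)%N ->
  character p q t = character p' q' t.
Proof.
by move=> e; rewrite -(character_shift p q q') e addnC (addnC q q') addnC character_shift.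
Qed.

Lemma character_conj p q t : conjc (character p q t) = character q p t.
Proof. by rewrite /character conjcM !conjcX conjcK mulrC. Qed.

Lemma normc_character p q t : normc (character p q t) = 1.
Proof. by rewrite /character normcM !normcX normcJ normc_polar// !expr1n mulr1. Qed.

Lemma continuous_character p q : continuous ((fun t => character p q t) : R -> R[i]^o).
Proof.
apply: continuous_mulc; apply: continuous_powc; first exact: continuous_polar.
by apply: continuous_conjc; exact: continuous_polar.
Qed.

Lemma measurable_character p q : measurable_circle (character p q : R -> R[i]).
Proof. by apply: continuous_circle_measurable; exact: continuous_character. Qed.

Lemma integral_character_neq p q : p != q -> integral_circle (character p q) = 0.
Proof.
wlog pq : p q / (q < p)%N => [hw|_].
  rewrite neq_ltn => /orP[pq|pq]; last by apply: hw => //; rewrite neq_ltn pq orbT.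
  have := hw q p pq; rewrite neq_ltn pq orbT => /(_ isT) h0.
  rewrite -[RHS]conjc0 -h0 -integral_circleJ.
    by apply: eq_integral_circle => t _; rewrite character_conj.
  by apply: continuous_integrable_circle; exact: continuous_character.
have h1 : holomorphic (fun=> 0 : R[i]) by move=> z _; exact: derivable_cst.
have r2 := radius01 R 0.
have j0 : (0 < p - q)%N by rewrite subn_gt0.
rewrite -[RHS](@vanishing_moments R _ _ _ 0 h1 r2 j0).
apply: eq_integral_circle => t _; rewrite expr0 mul1r.
by rewrite -/(character (p - q) 0 t); apply: character_eq; rewrite addn0 subnK// ltnW.
Qed.

Lemma integrable_circle_sum (I : Type) (r : seq I) (F : I -> R -> R[i]) :
  (forall i, integrable_circle (F i)) ->
  integrable_circle (fun t => \sum_(i <- r) F i t).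
Proof.
move=> Fi; elim: r => [|i r IH].
  by under eq_fun do rewrite big_nil; exact: integrable_circle_cst.
by under eq_fun do rewrite big_cons; exact: integrable_circleD.
Qed.

Lemma integral_circle_sum (I : Type) (r : seq I) (F : I -> R -> R[i]) :
  (forall i, integrable_circle (F i)) ->
  integral_circle (fun t => \sum_(i <- r) F i t) = \sum_(i <- r) integral_circle (F i).
Proof.
move=> Fi; elim: r => [|i r IH].
  rewrite big_nil -[RHS](integral_circle0 R).
  by apply: eq_integral_circle => t _; rewrite big_nil.
rewrite big_cons -IH -integral_circleD//; last exact: integrable_circle_sum.
by apply: eq_integral_circle => t _; rewrite big_cons.
Qed.

Lemma real_complex_nat k : (k%:R : R[i]) = (k%:R : R)%:C.
Proof. by rewrite -(rmorph_nat (real_complex R)). Qed.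

(** The de la Vallee-Poussin kernel: a nonnegative trigonometric polynomial
    concentrated on the diagonal. *)
Definition kernel_base s t : R := (1 + cos (s - t)) / 2.
Definition kernel n s t : R := kernel_base s t ^+ n.

Definition kernel_coef n (i : 'I_(2 * n).+1) : R[i] := 'C(2 * n, i)%:R / 4 ^+ n.

Lemma kernel_expand n s t : (kernel n s t)%:C =
  \sum_(i < (2 * n).+1) kernel_coef i * character n i s * character i n t.
Proof.
have base : (kernel_base s t)%:C =
    (polar 1 s + polar 1 t) ^+ 2 * conjc (polar 1 s) * conjc (polar 1 t) / 4.
  have e1 := polar1_conj s; have e2 := polar1_conj t.
  have -> : (polar 1 s + polar 1 t) ^+ 2 * conjc (polar 1 s) * conjc (polar 1 t) =
     (polar 1 s * conjc (polar 1 s)) * (polar 1 s * conjc (polar 1 t)) +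
     2 * (polar 1 s * conjc (polar 1 s)) * (polar 1 t * conjc (polar 1 t)) +
     (polar 1 t * conjc (polar 1 t)) * (polar 1 t * conjc (polar 1 s)) by ring.
  rewrite e1 e2 !mul1r mulr1 !conjc_polar !polarM mulr1.
  have -> : polar 1 (s - t) + 2 * 1 + polar 1 (t - s) = (4 * kernel_base s t)%:C.
    rewrite (real_complex_nat 2) /kernel_base /polar -[t - s]opprB cosN sinN; simpc.
    apply/eqP; rewrite eq_complex /=; apply/andP; split; apply/eqP; last by ring.
    by field.
  by rewrite -mul_real_complex -real_complex_nat mulrC mulrA mulVf ?mul1r.
have powE (A B C D : R[i]) : (A ^+ 2 * B * C / D) ^+ n = A ^+ (2 * n) * B ^+ n * C ^+ n / D ^+ n.
  by rewrite -exprVn exprM -!exprMn.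
rewrite /kernel (rmorphXn (real_complex R)) /= base powE exprDn.
rewrite !mulr_suml; apply: eq_bigr => i _.
have -> : character n i s = character (2 * n - i) n s.
  by apply: character_eq; rewrite subnK; [rewrite mul2n addnn|rewrite -ltnS].
by rewrite /kernel_coef /character -mulr_natr; ring.
Qed.

End TrigonometricKernel.
Arguments kernel_coef {R n} i.

(** * Approximation by the kernel *)

Section Completeness.
Variable R : realType.
Local Notation mu := (@lebesgue_measure R).
Implicit Types (f g : R -> R[i]) (u : R -> R) (s t : R).

Lemma continuous_kernel n s : continuous (kernel n s).
Proof.
have cb : continuous (kernel_base s).
  move=> t; apply: cvgM; last exact: cvg_cst.
  apply: cvgD; first exact: cvg_cst.
  apply: (@continuous_comp _ _ _ (fun t => s - t) cos); last exact: continuous_cos.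
  by apply: cvgB; [exact: cvg_cst|exact: cvg_id].
move=> t; apply: (@continuous_comp _ _ _ (kernel_base s) (fun x => x ^+ n)).
  exact: cb.
exact: exprn_continuous.
Qed.

Lemma kernel_base01 s t : 0 <= kernel_base s t <= 1.
Proof.
by rewrite /kernel_base; have := cos_geN1 (s - t); have := cos_le1 (s - t); lra.
Qed.

Lemma kernel_ge0 n s t : 0 <= kernel n s t.
Proof. by have /andP[k0 _] := kernel_base01 s t; exact: exprn_ge0. Qed.

Lemma kernel_integrable n s (a b : R) : mu.-integrable `[a, b] (EFin \o kernel n s).
Proof. by apply: continuous_itv_integrable => t _; exact: continuous_kernel. Qed.

Lemma kernel_transform_expand n s f : integrable_circle f ->
  integral_circle (fun t => f t * (kernel n s t)%:C) =
  \sum_(i < (2 * n).+1) kernel_coef i * integral_circle (fun t => f t * character i n t) *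
    character n i s.
Proof.
move=> fi.
have fci p q : integrable_circle (fun t => f t * character p q t).
  apply: (integrable_circleMbounded (M := 1) fi); first exact: measurable_character.
  by apply: ae_circle_all => t _; rewrite normc_character.
transitivity (integral_circle (fun t => \sum_(i < (2 * n).+1)
    (kernel_coef i * character n i s) * (f t * character i n t))).
  apply: eq_integral_circle => t _; rewrite kernel_expand mulr_sumr.
  by apply: eq_bigr => i _; ring.
rewrite integral_circle_sum; last by move=> i; exact: integrable_circleZ.
by apply: eq_bigr => i _; rewrite integral_circleZ// mulrAC.
Qed.

Definition kernel_mass n : R := \int[mu]_(t in @angles R) kernel n 0 t.

(** Only the term of frequency zero of the expansion survives the integration, and it does
    not depend on [s]. *)
Lemma kernel_massE n s : \int[mu]_(t in @angles R) kernel n s t = kernel_mass n.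
Proof.
have E x : (integral_circle (fun t => (kernel n x t)%:C)) =
    \sum_(i < (2 * n).+1) kernel_coef i * integral_circle (fun t => 1 * character i n t).
  have -> : integral_circle (fun t => (kernel n x t)%:C) =
      integral_circle (fun t => 1 * (kernel n x t)%:C).
    by apply: eq_integral_circle => t _; rewrite mul1r.
  rewrite (kernel_transform_expand n x (integrable_circle_cst _)).
  apply: eq_bigr => i _; have [->|ni] := eqVneq (i : nat) n.
    by rewrite /character -exprMn polar1_conj expr1n mulr1.
  have -> : integral_circle (fun t : R => 1 * character i n t) = 0.
    rewrite -[RHS](integral_character_neq R ni).
    by apply: eq_integral_circle => t _; rewrite mul1r.
  by rewrite mulr0 mul0r.
by have := etrans (E s) (esym (E 0)) => -[].
Qed.

Lemma cos_antimono (a b : R) : 0 <= a -> a <= b -> b <= pi -> cos b <= cos a.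
Proof.
move=> a0; rewrite le_eqVlt => /orP[/eqP->//|ab] bpi; apply/ltW.
by rewrite ltr_cos ?in_itv/= ?a0 ?bpi ?(le_trans a0 (ltW ab))// (le_trans (ltW ab)).
Qed.

Lemma cos_le_away (d x : R) : 0 <= d <= pi -> d <= `|x| <= 2 * pi - d -> cos x <= cos d.
Proof.
move=> /andP[d0 dpi] /andP[dx xd]; rewrite -(cos_norm x).
have [xpi|/ltW xpi] := leP `|x| pi; first exact: cos_antimono.
rewrite -(cosN `|x|) -(cosD2pi (- `|x|)); apply: cos_antimono => //.
  by rewrite mulr2n; lra.
by rewrite mulr2n; lra.
Qed.

Lemma kernel_mass_ge (s d : R) n : 0 < d -> d <= s -> d <= 2 * pi - s ->
  ((1 + cos d) / 2) ^+ n * (2 * d) <= kernel_mass n.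
Proof.
move=> d0 ds ds'; rewrite -(kernel_massE n s) /angles.
have sd0 : 0 <= s - d by rewrite subr_ge0.
have sd2 : s + d <= 2 * pi by rewrite -lerBrDl.
have sd : s - d <= s + d by lra.
rewrite (Rintegral_itv_split (kernel_integrable n s 0 (2 * pi)) sd0 (le_trans sd sd2)).
rewrite (Rintegral_itv_split (kernel_integrable n s (s - d) (2 * pi)) sd sd2).
have i1 : 0 <= \int[mu]_(t in `[0, s - d]) kernel n s t.
  by apply: Rintegral_ge0 => t _; exact: kernel_ge0.
have i3 : 0 <= \int[mu]_(t in `[s + d, 2 * pi]) kernel n s t.
  by apply: Rintegral_ge0 => t _; exact: kernel_ge0.
have i2 : ((1 + cos d) / 2) ^+ n * (2 * d) <= \int[mu]_(t in `[s - d, s + d]) kernel n s t.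
  have -> : 2 * d = (s + d) - (s - d) by ring.
  rewrite -(lebesgue_itv sd) -Rintegral_cst//.
  apply: le_Rintegral => //; [exact: cst_itv_integrable|exact: kernel_integrable|].
  move=> t; rewrite /= in_itv/= => /andP[t1 t2].
  have q0 : 0 <= (1 + cos d) / 2 by have := cos_geN1 d; lra.
  have q1 : (1 + cos d) / 2 <= kernel_base s t.
    have : cos d <= cos (s - t).
      rewrite -(cos_norm (s - t)); apply: cos_antimono => //; last lra.
      by rewrite ler_norml; lra.
    by rewrite /kernel_base; lra.
  by apply: lerXn2r; rewrite ?nnegrE// (le_trans q0).
by rewrite -[leLHS]add0r lerD// -[leLHS]addr0 lerD.
Qed.

Lemma kernel_mass_gt0 n : 0 < kernel_mass n.
Proof.
have p0 := pi_gt0 R.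
apply: lt_le_trans (@kernel_mass_ge pi (pi / 2) n _ _ _); [|lra|lra|lra].
by rewrite cos_pihalf addr0 mulr_gt0 ?exprn_gt0//; lra.
Qed.

(** Both the tail and the mass of the kernel are compared with powers: away from the
    diagonal the base is at most [q], while close to it the base is at least
    [q' > q]. *)
Lemma kernel_approximation u s (M : R) : 0 < s < 2 * pi ->
  measurable_fun (@angles R) u -> (forall t, `|u t| <= M) -> {for s, continuous u} ->
  (\int[mu]_(t in @angles R) (u t * kernel n s t)) / kernel_mass n @[n --> \oo] --> u s.
Proof.
move=> /andP[s0 s2] mu_ uM cu.
have M0 : 0 <= M := le_trans (normr_ge0 _) (uM 0).
have p0 := pi_gt0 R.
have uki n : mu.-integrable (@angles R) (EFin \o (fun t => u t * kernel n s t)).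
  apply: (@le_integrable _ _ _ mu _ (@measurable_angles R) _ (EFin \o (fun t => M * kernel n s t))).
  - apply/measurable_EFinP; apply: measurable_funM => //.
    by apply/measurable_EFinP; exact: (measurable_int mu (kernel_integrable n s 0 (2 * pi))).
  - move=> t _; rewrite /comp !abse_EFin lee_fin !normrM (ger0_norm M0).
    by rewrite ler_wpM2r.
  - by apply: integrable_realZ; exact: kernel_integrable.
apply/cvgrPdist_le => e e0.
have [d [d0 ds ds' ud]] : exists d, [/\ 0 < d, d <= s, d <= 2 * pi - s &
    forall t, `|s - t| <= d -> `|u t - u s| <= e / 2].
  move: cu => /cvgrPdist_le /(_ (e / 2)); rewrite divr_gt0// => /(_ isT).
  move=> /nbhs_ballP[d /= d0 hd].
  pose d' := Num.min (d / 2) (Num.min s (2 * pi - s)).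
  have h1 : d' <= d / 2 by rewrite ge_min lexx.
  exists d'; split; rewrite ?ge_min ?lexx ?orbT//.
    by rewrite !lt_min divr_gt0// s0 subr_gt0.
  move=> t td; rewrite distrC; apply: hd; rewrite /ball /=; lra.
(* [q] bounds the base of the kernel at distance at least [d] from the diagonal, [q'] is
   a lower bound for it at distance at most [d / 2]. *)
pose q := (1 + cos d) / 2; pose q' := (1 + cos (d / 2)) / 2.
have q0 : 0 <= q by rewrite /q; have := cos_geN1 d; lra.
have qq' : q < q'.
  have : cos d < cos (d / 2) by rewrite ltr_cos ?in_itv/=; [lra|apply/andP; split; lra|apply/andP; split; lra].
  by rewrite /q /q'; lra.
have q'0 : 0 < q' by exact: le_lt_trans qq'.
have est n : `|\int[mu]_(t in @angles R) (u t * kernel n s t) - u s * kernel_mass n| <=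
    e / 2 * kernel_mass n + 4 * pi * M * q ^+ n.
  rewrite -(kernel_massE n s) -(RintegralZl (u s))//; last exact: kernel_integrable.
  rewrite -RintegralB//; last by apply: integrable_realZ; exact: kernel_integrable.
  have di : mu.-integrable (@angles R) (EFin \o (fun t => u t * kernel n s t - u s * kernel n s t)).
    under eq_fun do rewrite -mulNr; apply: integrable_realD => //.
    by apply: integrable_realZ; exact: kernel_integrable.
  apply: (le_trans (le_normr_Rintegral _ di)) => //.
  have -> : 4 * pi * M * q ^+ n = 2 * M * q ^+ n * fine (mu (@angles R)).
    by rewrite angles_length; ring.
  rewrite -(RintegralZl (e / 2))//; last exact: kernel_integrable.
  rewrite -(Rintegral_cst mu (@measurable_angles R)) -RintegralD//; last 2 first.
  - by apply: integrable_realZ; exact: kernel_integrable.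
  - exact: cst_itv_integrable.
  apply: le_Rintegral => //; first exact: integrable_norm.
    apply: integrable_realD; last exact: cst_itv_integrable.
    by apply: integrable_realZ; exact: kernel_integrable.
  move=> t; rewrite /angles /= in_itv/= => /andP[t0 t2].
  have K0 := kernel_ge0 n s t.
  rewrite -mulrBl normrM (ger0_norm K0).
  have [td|/ltW td] := leP `|s - t| d.
    apply: (@le_trans _ _ (e / 2 * kernel n s t)); first by rewrite ler_wpM2r// ud.
    by rewrite lerDl mulr_ge0 ?exprn_ge0// mulr_ge0.
  have Kq : kernel n s t <= q ^+ n.
    have /andP[b0 _] := kernel_base01 s t.
    apply: lerXn2r; rewrite ?nnegrE//.
    suff : cos (s - t) <= cos d by rewrite /kernel_base /q; lra.
    apply: cos_le_away; apply/andP; split; [lra|lra|exact: td|].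
    by rewrite ler_norml; lra.
  apply: (@le_trans _ _ (2 * M * q ^+ n)); last by rewrite lerDr mulr_ge0// divr_ge0// ltW.
  apply: ler_pM => //; apply: (le_trans (ler_normB _ _)).
  by have := uM t; have := uM s; lra.
have geo : (4 * pi * M * (q / q') ^+ n) @[n --> \oo] --> (0 : R).
  have := @cvg_geometric R (4 * pi * M) (q / q'); rewrite /geometric /=; apply.
  rewrite ger0_norm; first by rewrite ltr_pdivrMr// mul1r.
  by rewrite divr_ge0// ltW.
have ed0 : 0 < e / 2 * d by rewrite mulr_gt0// divr_gt0.
move: geo => /cvgrPdist_le /(_ _ ed0); apply: filterS => n.
rewrite sub0r normrN ger0_norm; last first.
  by rewrite !mulr_ge0 ?exprn_ge0 ?divr_ge0 ?(ltW p0)// ltW.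
rewrite expr_div_n mulrA ler_pdivrMr ?exprn_gt0// => geo.
have mge : q' ^+ n * d <= kernel_mass n.
  have dE : 2 * (d / 2) = d by field.
  rewrite -[X in _ * X]dE; apply: (@kernel_mass_ge s (d / 2) n); lra.
have mn := kernel_mass_gt0 n.
have -> : u s - \int[mu]_(t in @angles R) (u t * kernel n s t) / kernel_mass n =
    - (\int[mu]_(t in @angles R) (u t * kernel n s t) - u s * kernel_mass n) / kernel_mass n.
  by field; rewrite gt_eqF.
rewrite normrM normrN normfV (gtr0_norm mn) ler_pdivrMr//.
apply: (le_trans (est n)).
have : e / 2 * (q' ^+ n * d) <= e / 2 * kernel_mass n by rewrite ler_wpM2l// divr_ge0// ltW.
lra.
Qed.

End Completeness.

(** * Uniqueness of Fourier coefficients *)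

Section SpectralUniqueness.
Variable R : realType.
Local Notation mu := (@lebesgue_measure R).
Implicit Types (f g : R -> R[i]) (u : R -> R) (s t : R).

Lemma Re_mul_real (z : R[i]) (k : R) : complex.Re (z * k%:C) = complex.Re z * k.
Proof. by rewrite ReM /= mulr0 subr0. Qed.

Lemma Im_mul_real (z : R[i]) (k : R) : complex.Im (z * k%:C) = complex.Im z * k.
Proof. by rewrite ImM /= mulr0 add0r. Qed.

Lemma ae_circle_interior : ae_circle (fun t : R => 0 < t < 2 * pi).
Proof.
apply: (ae_circleS2 _ (ae_circle_neq 0) (ae_circle_neq (2 * pi))) => t.
rewrite /angles /= in_itv/= => /andP[t0 t2] /eqP tn0 /eqP tn2.
by rewrite !lt_neqAle t0 t2 tn2 eq_sym tn0.
Qed.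

(** The kernel transforms of [f] are trigonometric polynomials with frequencies among those
    of [f], so that their integrals against [g] are finite sums of zeros; they tend to
    [f] at its points of continuity. *)
Lemma disjoint_spectra f g (M : R) : measurable_circle f -> (forall t, normc (f t) <= M) ->
  ae_circle (fun t => {for t, continuous (f : R -> R[i]^o)}) -> integrable_circle g ->
  (forall p q, integral_circle (fun t => f t * character p q t) = 0 \/
               integral_circle (fun t => g t * character q p t) = 0) ->
  integral_circle (fun t => g t * f t) = 0.
Proof.
move=> mf fM cf gi fg.
have fi : integrable_circle f.
  by apply: (bounded_integrable_circle mf (M := M)); exact: ae_circle_all.
pose T n s := integral_circle (fun t => f t * (kernel n s t)%:C) * ((kernel_mass R n)^-1)%:C.
have gci p q : integrable_circle (fun t => g t * character p q t).
  apply: (integrable_circleMbounded (M := 1) gi); first exact: measurable_character.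
  by apply: ae_circle_all => t _; rewrite normc_character.
have TE n s : T n s = \sum_(i < (2 * n).+1) (kernel_coef i *
    integral_circle (fun t => f t * character i n t) * ((kernel_mass R n)^-1)%:C) *
    character n i s.
  rewrite /T kernel_transform_expand// mulr_suml.
  by apply: eq_bigr => i _; rewrite mulrAC.
have mT n : measurable_circle (T n).
  have -> : T n = (fun s => \sum_(i < (2 * n).+1) (kernel_coef i *
    integral_circle (fun t => f t * character i n t) * ((kernel_mass R n)^-1)%:C) *
    character n i s) by apply/funext => s; exact: TE.
  apply: integrable_circle_measurable; apply: integrable_circle_sum => i.
  apply: integrable_circleZ; apply: continuous_integrable_circle.
  exact: continuous_character.
have int0 n : integral_circle (fun s => g s * T n s) = 0.
  transitivity (integral_circle (fun s => \sum_(i < (2 * n).+1) (kernel_coef i *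
    integral_circle (fun t => f t * character i n t) * ((kernel_mass R n)^-1)%:C) *
    (g s * character n i s))).
    apply: eq_integral_circle => s _; rewrite TE mulr_sumr.
    by apply: eq_bigr => i _; rewrite mulrCA.
  rewrite integral_circle_sum; last by move=> i; exact: integrable_circleZ.
  rewrite big1// => i _; rewrite integral_circleZ//.
  by have [->|->] := fg i n; rewrite ?mulr0 ?mul0r.
have ReT n s : complex.Re (T n s) =
    (\int[mu]_(t in @angles R) (complex.Re (f t) * kernel n s t)) / kernel_mass R n.
  rewrite /T Re_mul_real; congr (_ / _); apply: eq_Rintegral => t _.
  exact: Re_mul_real.
have ImT n s : complex.Im (T n s) =
    (\int[mu]_(t in @angles R) (complex.Im (f t) * kernel n s t)) / kernel_mass R n.
  rewrite /T Im_mul_real; congr (_ / _); apply: eq_Rintegral => t _.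
  exact: Im_mul_real.
have mgf h : measurable_circle h -> measurable_circle (fun t => g t * h t).
  by move=> mh; apply: measurable_circleM => //; exact: integrable_circle_measurable.
have [mfR mfI] := mf.
have RM t : `|complex.Re (f t)| <= M by exact: le_trans (Re_le_normc _) (fM t).
have IM t : `|complex.Im (f t)| <= M by exact: le_trans (Im_le_normc _) (fM t).
have bound u s n : measurable_fun (@angles R) u -> (forall t, `|u t| <= M) ->
    `|(\int[mu]_(t in @angles R) (u t * kernel n s t)) / kernel_mass R n| <= M.
  move=> mu_ uM; rewrite normrM normfV (gtr0_norm (kernel_mass_gt0 R n)) ler_pdivrMr ?kernel_mass_gt0//.
  rewrite -(kernel_massE n s) -RintegralZl//; last exact: kernel_integrable.
  have Mki : mu.-integrable (@angles R) (EFin \o (fun t => M * kernel n s t)).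
    by apply: integrable_realZ; exact: kernel_integrable.
  have le1 t : `|u t * kernel n s t| <= M * kernel n s t.
    by rewrite normrM (ger0_norm (kernel_ge0 _ _ _)) ler_wpM2r// kernel_ge0.
  have uki : mu.-integrable (@angles R) (EFin \o (fun t => u t * kernel n s t)).
    apply: (@le_integrable _ _ _ mu _ (@measurable_angles R) _ (EFin \o (fun t => M * kernel n s t))) => //.
    - apply/measurable_EFinP; apply: measurable_funM => //.
      by apply/measurable_EFinP; exact: (measurable_int mu (kernel_integrable n s 0 (2 * pi))).
    - move=> t _; rewrite /comp !abse_EFin lee_fin.
      exact: le_trans (le1 t) (ler_norm _).
  apply: (le_trans (le_normr_Rintegral _ uki)) => //.
  by apply: le_Rintegral => //; exact: integrable_norm.
have [] := @dominated_integral_circle R (fun n s => g s * T n s) (fun s => g s * f s)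
  (fun s => 2 * M * (`|complex.Re (g s)| + `|complex.Im (g s)|)).
- by move=> n; exact: mgf.
- exact: mgf.
- apply: (ae_circleS2 _ ae_circle_interior cf) => s _ s02 cfs.
  apply: cvgM; first exact: cvg_cst.
  have [cR cI] := cvgc_ReIm _ cfs.
  apply: ReIm_cvgc.
    under eq_fun do rewrite ReT.
    exact: kernel_approximation s02 mfR RM cR.
  under eq_fun do rewrite ImT.
  exact: kernel_approximation s02 mfI IM cI.
- by apply: integrable_realZ; exact: integrable_circle_norm1.
- apply: ae_circle_all => s _ n; rewrite normcM mulrC.
  apply: ler_pM; [exact: normc_ge0|exact: normc_ge0| |exact: normc_le_ReIm].
  apply: (le_trans (normc_le_ReIm _)); rewrite ReT ImT.
  by rewrite mulr2n mulrDl mul1r lerD//; exact: bound.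
- by move=> _; apply.
Qed.

(** By Lebesgue's differentiation theorem [u] is the derivative of its primitive almost
    everywhere. *)
Lemma zero_primitive_ae0 u : mu.-integrable (@angles R) (EFin \o u) ->
  (forall x, angles x -> \int[mu]_(t in `[0, x]) u t = 0) -> ae_circle (fun t => u t = 0).
Proof.
move=> ui u0; pose v := u \_ (@angles R).
have vi : locally_integrable [set: R] v by exact: integrable_locally.
have vint y : mu.-integrable `[0, y] (EFin \o v).
  apply: (@integrableS _ _ _ mu setT) => //.
  rewrite /v -(restrict_EFin u); exact/(integrable_mkcond _ _).1.
have ftc := @FTC1 R v (BLeft 0) vint vi.
have intv x : 0 <= x <= 2 * pi -> \int[mu]_(t in `[0, x]) v t = 0.
  move=> x02; rewrite -[RHS](u0 x); last by rewrite /angles /= in_itv.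
  apply: eq_Rintegral => t; rewrite inE /= in_itv/= => /andP[t0 tx].
  rewrite /v patchE mem_set// /angles /= in_itv/= t0.
  by have /andP[_ x2] := x02; exact: le_trans tx x2.
have ftc' : ae_circle (fun t => 0 < t -> v t = derive1 (fun x => \int[mu]_(t in `[0, x]) v t) t).
  apply: (@filterS _ _ (ae_filter_ringOfSetsType mu) _ _ _ ftc) => t H _ t0.
  by have [|_ ->] := H; first by rewrite lte_fin.
apply: (ae_circleS2 _ ae_circle_interior ftc') => t at_ /andP[t0 t2] /(_ t0).
rewrite {1}/v patchE mem_set// => ->.
rewrite derive1E (@near_eq_derive _ _ _ _ (cst 0)); first by rewrite derive_cst.
near=> x; apply: intv; apply/andP; split; apply: ltW; near: x.
  exact: lt_nbhsr.
exact: lt_nbhsl.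
Unshelve. all: by end_near. Qed.

Lemma Rintegral_indic_itv u x : angles x ->
  \int[mu]_(t in @angles R) (u t * \1_(`[0, x] : set R) t) = \int[mu]_(t in `[0, x]) u t.
Proof.
rewrite /angles /= in_itv/= => /andP[x0 x2].
rewrite (_ : [set` `[0, x]] = @angles R `&` [set` `[0, x]]); last first.
  apply/seteqP; split => t /=; last by case.
  rewrite /angles /= !in_itv/= => /andP[t0 tx]; split; rewrite t0 //=.
  exact: le_trans tx x2.
rewrite Rintegral_mkcondr; apply: eq_Rintegral => t at_.
rewrite patchE indicE; case: ifPn => tI.
  by rewrite mem_set ?mulr1//; split; [exact/set_mem|exact/set_mem].
rewrite memNset ?mulr0// => -[_ tI']; move: tI.
by rewrite mem_set.
Qed.

(** The indicator of an interval has one interior discontinuity at most, so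
    [disjoint_spectra] applies to it and all the primitives of [g] vanish. *)
Lemma character_complete g : integrable_circle g ->
  (forall p q, integral_circle (fun t => g t * character p q t) = 0) -> eq_ae g (fun=> 0).
Proof.
move=> gi g0.
have prim x : angles x -> integral_circle (fun t => g t * ((\1_(`[0, x] : set R) t)%:C)) = 0.
  move=> ax; apply: (@disjoint_spectra _ _ 1); [| | |exact: gi|by right].
  - split => /=; last exact: measurable_cst.
    exact: measurable_indic.
  - move=> t; rewrite normc_real indicE; case: (_ \in _); rewrite ?normr1 ?normr0//.
  - apply: (ae_circleS2 _ ae_circle_interior (ae_circle_neq x)) => t _ /andP[t0 _] /eqP tx.
    apply: cvg_near_cst; case: (ltgtP t x) tx => // tx' _; near=> y.
      have y0 : 0 < y by near: y; exact: lt_nbhsr.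
      have yx : y < x by near: y; exact: lt_nbhsl.
      by rewrite !indicE !mem_set//= in_itv/= ?(ltW y0) ?(ltW t0) ltW.
    have yx : x < y by near: y; exact: lt_nbhsr.
    by rewrite !indicE !memNset//= in_itv/= => /andP[_]; rewrite leNgt ?tx' ?yx.
have [gR gI] := gi.
have R0 : ae_circle (fun t => complex.Re (g t) = 0).
  apply: zero_primitive_ae0 => // x ax; rewrite -Rintegral_indic_itv//.
  have := congr1 (@complex.Re R) (prim x ax); rewrite /integral_circle /= => e.
  by rewrite -[RHS]e; apply: eq_Rintegral => t _; rewrite Re_mul_real.
have I0 : ae_circle (fun t => complex.Im (g t) = 0).
  apply: zero_primitive_ae0 => // x ax; rewrite -Rintegral_indic_itv//.
  have := congr1 (@complex.Im R) (prim x ax); rewrite /integral_circle /= => e.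
  by rewrite -[RHS]e; apply: eq_Rintegral => t _; rewrite Im_mul_real.
by apply: (ae_circleS2 _ R0 I0) => t _ r0 i0; rewrite (complex_eta (g t)) r0 i0.
Unshelve. all: by end_near. Qed.

End SpectralUniqueness.

(** * Means of inner functions *)

Section InnerFunctions.
Variable R : realType.
Local Notation mu := (@lebesgue_measure R).
Implicit Types (f g h m p theta : R -> R[i]) (F : R[i] -> R[i]).

Lemma inner_L2 theta : inner_function theta -> L2 theta.
Proof.
move=> [mt _ n1]; apply: (ae_eq_normc_L2 mt (L2_cst (1 : R[i]))).
by move: n1; apply: ae_circleS => t _ ->; rewrite normc1.
Qed.

Lemma inner_mean theta F : inner_function theta -> Hinfty_disc F ->
  boundary_value F theta -> integral_circle theta = (2 * pi)%:C * F 0.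
Proof.
move=> it hF bd; apply: boundary_mean => //; first by case: it.
exact: L2_integrable_circle (inner_L2 it).
Qed.

Lemma mul_conjc_normc1 (z : R[i]) : normc z = 1 -> z * conjc z = 1.
Proof. by move=> z1; rewrite mulcJ_normc z1 expr1n. Qed.

(** On the circle [(theta - c) conj (theta - c)] expands to [1 + |c| ^ 2] minus two terms
    that integrate to [2 pi |c| ^ 2], as [c] is the mean. *)
Lemma inner_variance theta F : inner_function theta -> Hinfty_disc F ->
  boundary_value F theta ->
  inner_product (fun t => theta t - F 0) (fun t => theta t - F 0) =
  (2 * pi * (1 - normc (F 0) ^+ 2))%:C.
Proof.
move=> it hF bd; have ti := L2_integrable_circle (inner_L2 it).
have [mt _ n1] := it; set c := F 0.
have mean := inner_mean it hF bd; rewrite -/c in mean.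
transitivity (integral_circle (fun t => (1 + c * conjc c) + (- conjc c * theta t + - c * conjc (theta t)))).
  apply: ae_eq_integral_circle.
  - have md : measurable_circle (fun t => theta t - c).
      by apply: measurable_circleD => //; exact: measurable_circle_cst.
    exact: measurable_circleM md (measurable_circleJ md).
  - apply: integrable_circle_measurable; apply: integrable_circleD.
      exact: integrable_circle_cst.
    by apply: integrable_circleD; apply: integrable_circleZ => //; exact: integrable_circleJ.
  - move: n1; apply: ae_circleS => t _ /mul_conjc_normc1 <-.
    by rewrite conjcB; ring.
rewrite integral_circleD; last 2 first.
- exact: integrable_circle_cst.
- by apply: integrable_circleD; apply: integrable_circleZ => //; exact: integrable_circleJ.
rewrite integral_circle_cst integral_circleD; last 2 first.
- exact: integrable_circleZ.
- by apply: integrable_circleZ; exact: integrable_circleJ.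
rewrite !integral_circleZ//; last exact: integrable_circleJ.
rewrite integral_circleJ// mean conjcM.
have -> : conjc (2 * pi)%:C = (2 * pi)%:C :> R[i] by exact: conjc_real.
have -> : (2 * pi * (1 - normc c ^+ 2))%:C = (2 * pi)%:C * (1 - c * conjc c).
  by rewrite mulcJ_normc -mul_real_complex; congr (_ * _); simpc.
ring.
Qed.

Lemma inner_center_le1 theta F : inner_function theta -> Hinfty_disc F ->
  boundary_value F theta -> normc (F 0) <= 1.
Proof.
move=> it hF bd; have := congr1 (@complex.Re R) (inner_variance it hF bd).
rewrite /inner_product /integral_circle /= => e.
have : 0 <= 2 * pi * (1 - normc (F 0) ^+ 2).
  rewrite -e; apply: Rintegral_ge0 => t _; rewrite mulcJ_normc; exact: sqr_ge0.
rewrite pmulr_rge0 ?mulr_gt0 ?pi_gt0// subr_ge0 => le1.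
by rewrite -(@ler_pXn2r _ 2) ?nnegrE ?normc_ge0// expr1n.
Qed.

(** The strict form of the maximum principle: the variance on the circle vanishes as
    soon as the mean has modulus one. *)
Lemma inner_center1_constant theta F : inner_function theta -> Hinfty_disc F ->
  boundary_value F theta -> normc (F 0) = 1 -> constant_circle theta.
Proof.
move=> it hF bd n1; exists (F 0).
have L := L2B (inner_L2 it) (L2_cst (F 0)).
have := inner_variance it hF bd; rewrite n1 expr1n subrr mulr0.
move=> /(inner_product_self_eq0 L); apply: ae_circleS => t _; exact: subr0_eq.
Qed.

(** The means of the factors have modulus at most one and their product is the value of
    the constant, which has modulus one; so both means have modulus one. *)
Lemma constant_inner_product_constant theta1 theta2 :
  inner_function theta1 -> inner_function theta2 ->
  constant_circle (fun t => theta1 t * theta2 t) ->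
  constant_circle theta1 /\ constant_circle theta2.
Proof.
move=> i1 i2 [c tc]; have [m1 [F1 h1 bd1] n1] := i1; have [m2 [F2 h2 bd2] n2] := i2.
have [m12 _ n12] := inner_functionM i1 i2.
have h12 : Hinfty_disc (fun z => F1 z * F2 z).
  move: h1 h2 => [H1 [M1 b1]] [H2 [M2 b2]].
  split; first by move=> z dz; apply: derivable_mulc; [exact: H1|exact: H2].
  exists (M1 * M2) => z dz; rewrite normcM.
  by apply: ler_pM; [exact: normc_ge0|exact: normc_ge0|exact: b1|exact: b2].
have bd12 : boundary_value (fun z => F1 z * F2 z) (fun t => theta1 t * theta2 t).
  by apply: (ae_circleS2 _ bd1 bd2) => t _ c1 c2; apply: cvgM; [exact: c1|exact: c2].
have var := inner_variance (inner_functionM i1 i2) h12 bd12.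
have mean := inner_mean (inner_functionM i1 i2) h12 bd12.
have pi2 : (2 * pi)%:C != 0 :> R[i].
  by rewrite eq_complex /= eqxx andbT lt0r_neq0// mulr_gt0 ?pi_gt0.
have c12 : c = F1 0 * F2 0.
  apply: (mulfI pi2); rewrite -mean -integral_circle_cst; apply/esym.
  apply: ae_eq_integral_circle => //; exact: measurable_circle_cst.
have var0 : inner_product (fun t => theta1 t * theta2 t - F1 0 * F2 0)
    (fun t => theta1 t * theta2 t - F1 0 * F2 0) = 0.
  rewrite -[RHS](integral_circle0 R); apply: ae_eq_integral_circle.
  - have md : measurable_circle (fun t => theta1 t * theta2 t - F1 0 * F2 0).
      by apply: measurable_circleD => //; exact: measurable_circle_cst.
    exact: measurable_circleM md (measurable_circleJ md).
  - exact: measurable_circle_cst.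
  - by move: tc; apply: ae_circleS => t _ ->; rewrite c12 subrr mul0r.
have n0 : normc (F1 0) * normc (F2 0) = 1.
  move: var; rewrite var0 normcM => /(congr1 (@complex.Re R)) /= /esym/eqP.
  rewrite mulf_eq0 mulf_eq0 pnatr_eq0 (gt_eqF (pi_gt0 R)) /= subr_eq0 eq_sym.
  by rewrite sqrf_eq1 => /orP[/eqP//|/eqP e]; have := mulr_ge0 (normc_ge0 (F1 0)) (normc_ge0 (F2 0));
    rewrite e; lra.
have l1 := inner_center_le1 i1 h1 bd1; have l2 := inner_center_le1 i2 h2 bd2.
have g1 := normc_ge0 (F1 0); have g2 := normc_ge0 (F2 0).
split.
  apply: (inner_center1_constant i1 h1 bd1); apply/eqP; rewrite eq_le l1 -n0 /=.
  by rewrite ler_piMr.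
apply: (inner_center1_constant i2 h2 bd2); apply/eqP; rewrite eq_le l2 -n0 /=.
by rewrite ler_piMl.
Qed.

End InnerFunctions.

(** * Rigidity of inner functions *)

Section Rigidity.
Variable R : realType.
Local Notation mu := (@lebesgue_measure R).

Lemma cvg_powc_0 (z : R[i]) : normc z < 1 -> ((z ^+ l : R[i]^o) @[l --> \oo] --> (0 : R[i]^o)).
Proof.
move=> z1; apply/cvgcP => e e0.
have := @cvg_expr R (normc z); rewrite ger0_norm ?normc_ge0// => /(_ z1).
move=> /cvgrPdist_lt /(_ e e0); apply: filterS => l.
by rewrite !sub0r !normrN normcN normcX ger0_norm// exprn_ge0// normc_ge0.
Qed.

Variables (theta m : R -> R[i]) (F : R[i] -> R[i]).
Hypotheses (it : inner_function theta) (hF : Hinfty_disc F) (bd : boundary_value F theta).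
Hypothesis Lm : L2 m.
Hypothesis orth : forall N, H2m (fun t => theta t ^+ N * m t).

Let c := F 0.
Let mt : measurable_circle theta. Proof. by case: it. Qed.
Let n1 : ae_circle (fun t => normc (theta t) = 1). Proof. by case: it. Qed.
Let mi : integrable_circle m. Proof. exact: L2_integrable_circle. Qed.

Let orth_character N k : integral_circle (fun t => theta t ^+ N * m t * character 0 k t) = 0.
Proof.
have [_ oN] := orth N; rewrite -(oN _ (H2p_monomial R k)).
apply: eq_integral_circle => t _; congr (_ * _).
by rewrite /character expr0 mul1r conjcX.
Qed.

(** [theta ^+ N * m] has only negative frequencies, while those of the circle restriction
    of [((F - F 0) / z) ^+ n * z ^+ k] are nonnegative. *)
Lemma inner_power_orthogonal (N n k : nat) :
  integral_circle (fun t => (theta t ^+ N * m t) *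
    conjc ((theta t - c) ^+ n * character k n t)) = 0.
Proof.
have [hol [M FM]] := hF.
have gi : integrable_circle (fun t => theta t ^+ N * m t).
  by apply: L2_integrable_circle; case: (orth N).
apply: (boundary_moments hol FM bd mt gi) => r r01.
have r01' : 0 <= r < 1 by have /andP[/ltW -> ->] := r01.
have cphi : continuous ((fun t => conjc ((F (polar r t) - c) ^+ n * character k n t)) : R -> R[i]^o).
  by apply: continuous_conjc; exact: moment_continuous.
apply: (@disjoint_spectra _ _ _ ((M + normc c) ^+ n)).
- exact: continuous_circle_measurable.
- move=> t; rewrite normcJ normcM normcX normc_character mulr1.
  have FM' := FM _ (disc_polar t r01').
  have M0 : 0 <= M := le_trans (normc_ge0 _) FM'.
  apply: lerXn2r; rewrite ?nnegrE; [exact: normc_ge0|exact: addr_ge0 M0 (normc_ge0 _)|].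
  by apply: (le_trans (le_normcD _ _)); rewrite normcN; apply: lerD.
- by apply: ae_circle_all => t _; exact: cphi.
- exact: gi.
move=> p q; have [pq|qp] := ltnP p q; [left|right].
  have j0 : (0 < k + q - p)%N by rewrite subn_gt0 ltn_addl.
  have := vanishing_moments n hol r01 j0; rewrite -/c => v0.
  rewrite -[RHS]conjc0 -[X in conjc X]v0 -integral_circleJ; last first.
    by apply: continuous_integrable_circle; exact: moment_continuous.
  apply: eq_integral_circle => t _.
  rewrite -[character p q t]conjcK character_conj -conjcM -mulrA.
  apply: (congr1 (fun z => conjc (_ * z))).
  rewrite -/(character (k + q - p) n t) {1 2}/character mulrACA -!exprD.
  by apply: character_eq; lia.
rewrite -[RHS](orth_character N (p - q)); apply: eq_integral_circle => t _.
by congr (_ * _); apply: character_eq; rewrite add0n subnKC.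
Qed.

(** On the circle [theta ^+ n * conjc (theta - c) ^+ n = (1 - conjc c * theta) ^+ n], so
    these integrals contain the previous ones; [n] counts the factors still to be divided
    out. *)
Let twist (n i p q : nat) :=
  integral_circle (fun t => m t * (theta t ^+ i * (1 - conjc c * theta t) ^+ n) * character p q t).

Let twist_measurable n i p q : measurable_circle (fun t =>
  m t * (theta t ^+ i * (1 - conjc c * theta t) ^+ n) * character p q t).
Proof.
apply: measurable_circleM; last exact: measurable_character.
apply: measurable_circleM; first by case: Lm.
apply: measurable_circleM; apply: measurable_circleX => //.
apply: measurable_circleD; first exact: measurable_circle_cst.
by apply: measurable_circleN; apply: measurable_circleM => //; exact: measurable_circle_cst.
Qed.

Let twist_bound n : ae_circle (fun t => forall i p q,
  normc (m t * (theta t ^+ i * (1 - conjc c * theta t) ^+ n) * character p q t) <=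
  (1 + normc c) ^+ n * (`|complex.Re (m t)| + `|complex.Im (m t)|)).
Proof.
move: n1; apply: ae_circleS => t _ t1 i p q.
rewrite normcM normc_character mulr1 !normcM !normcX t1 expr1n mul1r mulrC.
apply: ler_pM; [exact: exprn_ge0 (normc_ge0 _)|exact: normc_ge0| |exact: normc_le_ReIm].
apply: lerXn2r; rewrite ?nnegrE; [exact: normc_ge0|exact: addr_ge0 ler01 (normc_ge0 _)|].
by apply: (le_trans (le_normcD _ _)); rewrite normc1 normcN normcM normcJ t1 mulr1.
Qed.

Let twist_dom n : mu.-integrable (@angles R) (EFin \o (fun t =>
  (1 + normc c) ^+ n * (`|complex.Re (m t)| + `|complex.Im (m t)|))).
Proof. by apply: integrable_realZ; exact: integrable_circle_norm1. Qed.

Let twist_integrable n i p q : integrable_circle (fun t =>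
  m t * (theta t ^+ i * (1 - conjc c * theta t) ^+ n) * character p q t).
Proof.
apply: (dominated_integrable_circle (@twist_measurable n i p q) (twist_dom n)).
by apply: ae_circleS (twist_bound n) => t _.
Qed.

Let twist_base n i k : twist n i n k = 0.
Proof.
rewrite -(inner_power_orthogonal (i + n) n k); apply: ae_eq_integral_circle.
- exact: twist_measurable.
- apply: measurable_circleM; last apply: measurable_circleJ; apply: measurable_circleM.
  + exact: measurable_circleX.
  + by case: Lm.
  + apply: measurable_circleX; apply: measurable_circleD; first exact: mt.
    exact: measurable_circle_cst.
  + exact: measurable_character.
- move: n1; apply: ae_circleS => t _ /mul_conjc_normc1 t1.
  rewrite conjcM character_conj conjcX conjcB exprD.
  have -> : 1 - conjc c * theta t = theta t * (conjc (theta t) - conjc c).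
    by rewrite mulrBr t1 mulrC.
  by rewrite exprMn; ring.
Qed.

Let twist_step n i p q : twist n.+1 i p q = twist n i p q - conjc c * twist n i.+1 p q.
Proof.
rewrite /twist -integral_circleZ -?integral_circleB; try exact: twist_integrable.
  by apply: eq_integral_circle => t _; rewrite !exprS; ring.
by apply: integrable_circleZ; exact: twist_integrable.
Qed.

Hypothesis c1 : normc c < 1.

(** The recursion is solved backwards: [twist n i = (conjc c) ^+ l * twist n (i + l)] for
    all [l], and the right-hand side tends to zero. *)
Let twist_down n p q : (forall i, twist n.+1 i p q = 0) -> forall i, twist n i p q = 0.
Proof.
move=> H i.
have iter l : twist n i p q = conjc c ^+ l * twist n (i + l) p q.
  elim: l => [|l ->]; first by rewrite expr0 mul1r addn0.
  have := twist_step n (i + l) p q; rewrite H => /esym/subr0_eq ->.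
  by rewrite exprSr mulrA addnS.
have [] := @dominated_integral_circle R (fun l t => conjc c ^+ l * (m t *
     (theta t ^+ (i + l) * (1 - conjc c * theta t) ^+ n) * character p q t)) (fun=> 0)
  (fun t => (1 + normc c) ^+ n * (`|complex.Re (m t)| + `|complex.Im (m t)|)).
- move=> l; apply: measurable_circleM; first exact: measurable_circle_cst.
  exact: twist_measurable.
- exact: measurable_circle_cst.
- move: n1; apply: ae_circleS => t _ t1.
  pose d := m t * (theta t ^+ i * (1 - conjc c * theta t) ^+ n) * character p q t.
  rewrite -[X in _ --> X](mulr0 d).
  under eq_fun => l.
    rewrite (_ : _ * _ = d * (conjc c * theta t) ^+ l); first over.
    by rewrite /d exprD exprMn; ring.
  apply: cvgM; first exact: cvg_cst.
  by apply: cvg_powc_0; rewrite normcM normcJ t1 mulr1.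
- exact: twist_dom.
- move: (twist_bound n); apply: ae_circleS => t _ b l.
  rewrite normcM normcX normcJ; apply: le_trans (b (i + l)%N p q).
  by rewrite ler_piMl ?normc_ge0// exprn_ile1 ?normc_ge0// ltW.
move=> _ /(_ (twist n i p q)) => <-; first exact: integral_circle0.
by move=> l; rewrite integral_circleZ ?iter//; exact: twist_integrable.
Qed.

(** [twist_base] kills the frequencies up to [n] of [m * (1 - conjc c * theta) ^+ n]; starting
    from [n = p] and descending to [n = 0], [twist_down] reaches every frequency of [m]. *)
Lemma inner_rigidity : eq_ae m (fun=> 0).
Proof.
apply: character_complete => // p q.
have all0 n : (n <= p)%N -> forall i, twist (p - n) i p q = 0.
  elim: n => [_ i|n IH np]; first by rewrite subn0 twist_base.
  by apply: twist_down => i; rewrite -subSn// subSS; apply: IH; exact: ltnW.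
rewrite -(all0 p (leqnn p) 0) subnn; apply: eq_integral_circle => t _.
by rewrite !expr0 !mulr1.
Qed.

End Rigidity.

(** * Kernels of paired operators *)

Section KernelInclusion.
Variable R : realType.
Implicit Types (a b g h m p theta : R -> R[i]).

Lemma H2mZ (c : R[i]) m : H2m m -> H2m (fun t => c * m t).
Proof.
move=> [Lm om]; have [mm _] := Lm; split.
  apply: (L2_dominated _ (integrable_realZ (normc c ^+ 2) (L2_integrable Lm))).
    by apply: measurable_circleM => //; exact: measurable_circle_cst.
  by move=> t _; rewrite normcM exprMn.
move=> h hh; have [Lh _] := hh.
rewrite -[RHS](mulr0 c) -(om h hh) -integral_circleZ; last exact: L2_inner_integrable.
by apply: eq_integral_circle => t _; rewrite mulrA.
Qed.

Lemma zero_subspace_sub_kerp a b : @zero_subspace R `<=` kerp_paired a b.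
Proof.
move=> g [Lg g0]; apply/kerp_pairedP; split => //.
exists (fun=> 0), (fun=> 0); split => //; [exact: H2p_cst|exact: H2m0|].
by apply: ae_circle_all => t _; rewrite !mulr0 addr0.
Qed.

Variables (a b theta1 theta2 : R -> R[i]).
Hypotheses (i1 : inner_function theta1) (i2 : inner_function theta2).
Let theta t := theta1 t * theta2 t.
Let K := kerp_paired a b.
Let K' := kerp_paired (fun t => a t * theta1 t) (fun t => b t * conjc (theta2 t)).

Let unimodular : ae_circle (fun t => theta1 t * conjc (theta1 t) = 1 /\
  theta2 t * conjc (theta2 t) = 1).
Proof.
have [_ _ n1] := i1; have [_ _ n2] := i2.
by apply: (ae_circleS2 _ n1 n2) => t _ /mul_conjc_normc1 -> /mul_conjc_normc1 ->.
Qed.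

(** The minus component is multiplied by the conjugate of [theta1 * theta2], which
    preserves [H2m]. *)
Lemma twisted_kerp_sub : K' `<=` K.
Proof.
move=> g /kerp_pairedP[Lg [p [m [hp hm gp ker]]]]; apply/kerp_pairedP; split => //.
exists p, (fun t => conjc (theta t) * m t); split => //.
  exact: H2m_mul_inner_conj (inner_functionM i1 i2) hm.
apply: (ae_circleS2 _ ker unimodular) => t _ ker_t [u1 _].
rewrite /theta conjcM -[RHS](mulr0 (conjc (theta1 t))) -ker_t.
have -> : conjc (theta1 t) * (a t * theta1 t * p t + b t * conjc (theta2 t) * m t) =
  theta1 t * conjc (theta1 t) * (a t * p t) +
  b t * (conjc (theta1 t) * conjc (theta2 t) * m t) by ring.
by rewrite u1 mul1r.
Qed.

Lemma constant_twisted_kerp : constant_circle theta -> K `<=` K'.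
Proof.
move=> [c tc] g /kerp_pairedP[Lg [p [m [hp hm gp ker]]]]; apply/kerp_pairedP; split => //.
exists p, (fun t => c * m t); split => //; first exact: H2mZ.
have H := ae_circleS2 (fun t _ x y => conj x y) ker unimodular.
apply: (ae_circleS2 _ tc H) => t _ <- [ker_t [_ u2]].
rewrite -[RHS](mulr0 (theta1 t)) -ker_t /theta.
have -> : b t * conjc (theta2 t) * (theta1 t * theta2 t * m t) =
  theta2 t * conjc (theta2 t) * (theta1 t * (b t * m t)) by ring.
by rewrite u2; ring.
Qed.

Hypotheses (a0 : ae_circle (fun t => a t <> 0)) (b0 : ae_circle (fun t => b t <> 0)).

(** If the two kernels agree, the minus component of an element can be multiplied by
    [theta1 * theta2] indefinitely without leaving [H2m]. *)
Lemma kerp_sub_twisted_zero : K `<=` K' -> ~ constant_circle theta ->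
  K `<=` @zero_subspace R.
Proof.
move=> KK' nc g /kerp_pairedP[Lg [p [m [hp hm gp ker]]]].
pose pair p m := [/\ H2p p, H2m m & ae_circle (fun t => a t * p t + b t * m t = 0)].
have it := inner_functionM i1 i2.
have step p1 m1 : pair p1 m1 -> pair (fun t => theta t * p1 t) (fun t => theta t * m1 t).
  move=> [hp1 hm1 ker1].
  have /KK'/kerp_pairedP[_ [p' [m' [hp' hm' pp' ker']]]] : K p1.
    apply/kerp_pairedP; split; first exact: H2p_L2.
    by exists p1, m1; split => //; apply: ae_circle_all.
  have Lm1 := H2m_L2 hm1; have [mm1 _] := Lm1; have [mth _ nth] := it.
  have m'E : eq_ae (fun t => theta t * m1 t) m'.
    have H1 : ae_circle (fun t => a t * p1 t + b t * m1 t = 0 /\ b t <> 0).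
      exact: (ae_circleS2 _ ker1 b0).
    have H2 : ae_circle (fun t => p1 t = p' t /\ 
       a t * theta1 t * p' t + b t * conjc (theta2 t) * m' t = 0).
      exact: (ae_circleS2 _ pp' ker').
    have H3 : ae_circle (fun t => (p1 t = p' t /\ 
       a t * theta1 t * p' t + b t * conjc (theta2 t) * m' t = 0) /\
       (theta2 t * conjc (theta2 t) = 1)).
      by apply: (ae_circleS2 _ H2 unimodular) => t _ ? [].
    apply: (ae_circleS2 _ H1 H3) => t _ [k1 /eqP bt] [[e k2] u2].
    apply: (mulfI bt); rewrite /theta.
    have -> : b t * (theta1 t * theta2 t * m1 t) = theta1 t * theta2 t * (b t * m1 t) by ring.
    have -> : b t * m1 t = - (a t * p1 t) by apply/eqP; rewrite -subr_eq0 opprK addrC k1.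
    have -> : b t * m' t = theta2 t * conjc (theta2 t) * (b t * m' t) by rewrite u2 mul1r.
    have -> : theta2 t * conjc (theta2 t) * (b t * m' t) =
       theta2 t * (b t * conjc (theta2 t) * m' t) by ring.
    have -> : b t * conjc (theta2 t) * m' t = - (a t * theta1 t * p' t).
      by apply/eqP; rewrite -subr_eq0 opprK addrC k2.
    by rewrite e; ring.
  have Ltm : L2 (fun t => theta t * m1 t).
    apply: (ae_eq_normc_L2 (measurable_circleM mth mm1) Lm1).
    by move: nth; apply: ae_circleS => t _ e1; rewrite normcM e1 mul1r.
  split; first exact: H2p_mul_inner.
    split => // h hh; have [_ om'] := hm'; rewrite -(om' _ hh).
    have [[mh _] _] := hh; have [[mm' _] _] := hm'.
    apply: ae_eq_integral_circle.
    - by apply: measurable_circleM; [case: Ltm|exact: measurable_circleJ].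
    - by apply: measurable_circleM => //; exact: measurable_circleJ.
    - by move: m'E; apply: ae_circleS => t _ ->.
  move: ker1; apply: ae_circleS => t _ k1.
  by rewrite -[RHS](mulr0 (theta t)) -k1; ring.
have pairs N : pair (fun t => theta t ^+ N * p t) (fun t => theta t ^+ N * m t).
  elim: N => [|N IH].
    by under eq_fun do rewrite expr0 mul1r; under [X in pair _ X]eq_fun do rewrite expr0 mul1r.
  have := step _ _ IH.
  have E q : (fun t => theta t * (theta t ^+ N * q t)) = (fun t => theta t ^+ N.+1 * q t).
    by apply/funext => t; rewrite exprS mulrA.
  by rewrite !E.
have [_ [F hF bd] _] := it.
have c1 : normc (F 0) < 1.
  rewrite lt_neqAle (inner_center_le1 it hF bd) andbT; apply/eqP => c1.
  by apply: nc; exact: inner_center1_constant c1.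
have m0 : eq_ae m (fun=> 0).
  apply: (inner_rigidity it hF bd _ _ c1); first exact: H2m_L2.
  by move=> N; have [] := pairs N.
split => //; have H : ae_circle (fun t => g t = p t /\ m t = 0).
  exact: (ae_circleS2 _ gp m0).
have H' : ae_circle (fun t => a t * p t + b t * m t = 0 /\ a t <> 0).
  exact: (ae_circleS2 _ ker a0).
apply: (ae_circleS2 _ H H') => t _ [-> ->] [/eqP]; rewrite mulr0 addr0 mulf_eq0.
by move=> /orP[/eqP ->|/eqP].
Qed.

End KernelInclusion.

Theorem proposition3p1 (R : realType) (a b theta1 theta2 : R -> R[i])
  (a_Linfty : Linfty a) (b_Linfty : Linfty b)
  (a_neq0 : ae_circle (fun t => a t <> 0))
  (b_neq0 : ae_circle (fun t => b t <> 0))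
  (ab : eq_ae a b \/ ae_circle (fun t => a t - b t <> 0))
  (theta1_inner : inner_function theta1)
  (theta2_inner : inner_function theta2) :
  let K := kerp_paired a b in
  let K' := kerp_paired (fun t => a t * theta1 t) (fun t => b t * conjc (theta2 t)) in
  [/\ K' `<=` K,
      K <> @zero_subspace R ->
        (K' `<` K <-> ~ constant_circle (fun t => theta1 t * theta2 t)) &
      ~ constant_circle (fun t => theta1 t * theta2 t) <->
        (~ constant_circle theta1 \/ ~ constant_circle theta2)].
Proof.
move=> K K'; have K'K : K' `<=` K by exact: twisted_kerp_sub.
split => //.
- move=> Kn0; split.
    by move=> [_ nKK'] c; apply: nKK'; exact: constant_twisted_kerp.
  move=> nc; split => // KK'; apply: Kn0; apply/seteqP; split.
    exact: kerp_sub_twisted_zero KK' nc.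
  exact: zero_subspace_sub_kerp.
- split=> [nc|].
    have [[c1 e1]|] := pselect (constant_circle theta1); last by left.
    right => -[c2 e2]; apply: nc; exists (c1 * c2).
    by apply: (ae_circleS2 _ e1 e2) => t _ -> ->.
  move=> n12 /(constant_inner_product_constant theta1_inner theta2_inner)[k1 k2].
  by case: n12.
Qed.
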